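(* Given a 3-manifold triangulation $\mathcal{T}$ of size $n$, the isomorphism signature $\sigma(\mathcal{T})$ has $O(n\log n)$ size and can be generated in $O(n^2\log n)$ time.
   Context: A 3-manifold triangulation of size $n$ is a collection of $n$ abstract tetrahedra whose $4n$ faces are affinely identified in $2n$ pairs so that the resulting space is a connected closed 3-manifold. Faces of the same tetrahedron may be identified with each other. The triangulation is given as input by its table of face gluings. Size is measured in bits, and time accounts for manipulating tetrahedron labels of $O(\log n)$ bits (each such manipulation costs $O(\log n)$). A labelling of a triangulation of size $n$ numbers its tetrahedra $0,\dots,n-1$ and numbers the four vertices of each tetrahedron $0,\dots,3$; the faces of each tetrahedron are numbered so that face $i$ is opposite vertex $i$. Let $A_{t,f}\in\{0,\dots,n-1\}$ denote the tetrahedron glued to face $f$ of tetrahedron $t$. The labelling is canonical if, in the sequence $A_{0,0},A_{0,1},A_{0,2},A_{0,3},A_{1,0},\dots,A_{n-1,3}$: (i) for each $1\leq i<j$, tetrahedron $i$ first appears before tetrahedron $j$ first appears; and (ii) for each $i\geq 1$, if tetrahedron $i$ first appears as the entry $A_{t,f}=i$, then the corresponding gluing uses the identity map: face $f$ of tetrahedron $t$ is glued to face $f$ of tetrahedron $i$ so that vertex $v$ of tetrahedron $t$ maps to vertex $v$ of tetrahedron $i$ for each $v\neq f$. A triangulation of size $n$ has exactly $24n$ canonical labellings. The isomorphism signature $\sigma(\mathcal{T})$ is obtained by encoding, for each canonical labelling of $\mathcal{T}$, the full set of face gluings (the table of $4n$ cells giving, for each tetrahedron $t$ and face $f$, the adjacent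 tetrahedron and the images of the three vertices of the face, with integers written in binary) as a sequence of bits, and taking the lexicographically smallest of these $24n$ bit sequences. *)

(* Defs.v *)
From HB Require Import structures.
From Stdlib Require Import Relations.Relation_Operators.
From mathcomp Require Import all_boot all_order all_fingroup all_algebra.
From mathcomp Require Import all_classical all_reals all_analysis.
Set Implicit Arguments.
Unset Strict Implicit.
Unset Printing Implicit Defensive.
Import Order.TTheory GRing.Theory Num.Theory.
Import numFieldNormedType.Exports.
Local Open Scope classical_set_scope.
Local Open Scope quotient_scope.
Local Open Scope ring_scope.

(* A table of face gluings.  [T (t, f) = (u, p)] means that face [f] of
   tetrahedron [t] (the face opposite vertex [f]) is glued to face [p f] of
   tetrahedron [u], vertex [v] of [t] going to vertex [p v] of [u] for [v != f].
   The value of [p] at [f] carries no further data: it is forced by the others. *)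
Definition gluing (n : nat) := {ffun 'I_n * 'I_4 -> 'I_n * 'S_4}.

Definition adj n (T : gluing n) (t : 'I_n) (f : 'I_4) : 'I_n := (T (t, f)).1.
Definition gmap n (T : gluing n) (t : 'I_n) (f : 'I_4) : 'S_4 := (T (t, f)).2.

(* The 4n faces are identified in pairs: the face glued to a given face is a
   different face, and it is glued back by the inverse map. *)
Definition paired n (T : gluing n) : Prop :=
  forall (t : 'I_n) (f : 'I_4),
    (adj T t f, gmap T t f f) <> (t, f) /\
    T (adj T t f, gmap T t f f) = (t, (gmap T t f)^-1%g).

Section Realization.
Variables (R : realType) (n : nat) (T : gluing n).

(* The standard tetrahedron, in barycentric coordinates. *)
Definition tetrahedron : set 'rV[R]_4 :=
  [set x | (forall v, 0 <= x ord0 v) /\ \sum_v x ord0 v = 1].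

Definition tetrahedra : topologicalType := {t : 'I_n & set_type tetrahedron}.

Definition glued (a b : tetrahedra) : Prop :=
  exists f : 'I_4,
    [/\ set_val (projT2 a) ord0 f = 0,
        projT1 b = adj T (projT1 a) f
      & forall v, set_val (projT2 b) ord0 (gmap T (projT1 a) f v)
                  = set_val (projT2 a) ord0 v].

Definition identified (a b : tetrahedra) : bool :=
  `[< clos_refl_sym_trans _ glued a b >].

Lemma identified_refl : reflexive identified.
Proof. by move=> a; apply/asboolP; exact: rst_refl. Qed.

Lemma identified_sym : symmetric identified.
Proof.
by move=> a b; apply/asboolP/asboolP; exact: rst_sym.
Qed.

Lemma identified_trans : transitive identified.
Proof.
by move=> b a c /asboolP ab /asboolP bc; apply/asboolP; exact: rst_trans ab bc.
Qed.

Canonical identified_equiv :=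
  EquivRel identified identified_refl identified_sym identified_trans.

Definition realization : topologicalType :=
  quotient_topology {eq_quot identified_equiv}.

End Realization.

Definition locally_euclidean (R : realType) (d : nat) (X : topologicalType) :=
  forall x : X, exists (U : set X) (V : set 'rV[R]_d)
                       (phi : X -> 'rV[R]_d) (psi : 'rV[R]_d -> X),
    [/\ open U, U x & open V] /\
    [/\ {within U, continuous phi}, {within V, continuous psi},
        {homo phi : y / U y >-> V y}, {homo psi : y / V y >-> U y}
      & (forall y, U y -> psi (phi y) = y) /\
        (forall z, V z -> phi (psi z) = z)].

Definition closed_manifold (R : realType) (d : nat) (X : topologicalType) :=
  [/\ hausdorff_space X, @second_countable X, locally_euclidean R d X
    & compact [set: X]].

Definition triangulation3 (R : realType) (n : nat) (T : gluing n) : Prop :=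
  [/\ (0 < n)%N, paired T, closed_manifold R 3 (realization R T)
    & connected [set: realization R T]].

(* Tetrahedron [t] receives the number [l.1 t], and its vertex [v] receives the
   number [l.2 t v]. *)
Definition labelling (n : nat) : finType := ('S_n * {ffun 'I_n -> 'S_4})%type.

(* Permutations compose from left to right: [(p * q) x = q (p x)]. *)
Definition relabel n (T : gluing n) (l : labelling n) : gluing n :=
  [ffun tf : 'I_n * 'I_4 =>
     let t := (l.1^-1)%g tf.1 in
     let f := ((l.2 t)^-1)%g tf.2 in
     let u := adj T t f in
     (l.1 u, ((l.2 t)^-1 * gmap T t f * l.2 u)%g)].

Definition adj_seq n (T : gluing n) : seq 'I_n :=
  [seq adj T t f | t <- enum 'I_n, f <- enum 'I_4].

(* The entry [adj T t f] stands at position [4 * t + f] of [adj_seq T].  Since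
   the face [f] of [t] is glued to face [gmap T t f f], [gmap T t f = 1] says that
   face f is glued to face f by the identity map. *)
Definition canonical n (T : gluing n) : bool :=
  [forall i : 'I_n, forall j : 'I_n,
     (0 < i < j)%N ==> (index i (adj_seq T) < index j (adj_seq T))%N] &&
  [forall t : 'I_n, forall f : 'I_4,
     (0 < adj T t f)%N && (index (adj T t f) (adj_seq T) == 4 * t + f)%N
       ==> (gmap T t f == 1%g)].

Definition face_images n (T : gluing n) (t : 'I_n) (f : 'I_4) : seq nat :=
  [seq val (gmap T t f v) | v <- enum 'I_4 & v != f].

(* [k] in binary on [w] digits, most significant digit first. *)
Definition binary (w k : nat) : seq bool :=
  mkseq (fun i => odd (k %/ 2 ^ (w - i.+1))) w.

Definition bitlen (k : nat) : nat := (trunc_log 2 k).+1.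

(* Tetrahedra are written on the number of digits of the largest label n-1, and
   vertices on two digits, so that no separators are needed. *)
Definition encode n (T : gluing n) : seq bool :=
  flatten [seq binary (bitlen n.-1) (adj T t f)
               ++ flatten [seq binary 2 v | v <- face_images T t f]
          | t <- enum 'I_n, f <- enum 'I_4].

Definition isosig n (T : gluing n) : seq bool :=
  head [::]
    (sort (<=%O : rel (seqlexi bool))
       [seq encode (relabel T l)
       | l <- enum (labelling n) & canonical (relabel T l)]).

(* Random access machine with logarithmic costs, programmed with structured
   control flow.  Registers are indexed by and contain natural numbers; the
   input is a read-only array and the output is write-only.  Each operation is
   charged the number of binary digits of its operands, addresses included. *)
Inductive expr : Type :=
| Const of nat
| Input of expr
| Reg of expr
| Add of expr & expr
| Sub of expr & expr.

Inductive cmd : Type :=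
| Skip
| Assign of expr & expr (* Reg e1 := e2 *)
| Write of expr
| Seq of cmd & cmd
| If of expr & cmd & cmd
| While of expr & cmd.

Definition mem := nat -> nat.

Definition upd (m : mem) (a k : nat) : mem :=
  fun b => if b == a then k else m b.

Section Semantics.
Variable inp : mem.

Fixpoint eval (m : mem) (e : expr) : nat :=
  match e with
  | Const k => k
  | Input e1 => inp (eval m e1)
  | Reg e1 => m (eval m e1)
  | Add e1 e2 => (eval m e1 + eval m e2)%N
  | Sub e1 e2 => (eval m e1 - eval m e2)%N
  end.

Fixpoint ecost (m : mem) (e : expr) : nat :=
  match e with
  | Const k => bitlen k
  | Input e1 | Reg e1 => (ecost m e1 + bitlen (eval m e1) + bitlen (eval m e))%N
  | Add e1 e2 | Sub e1 e2 =>
      (ecost m e1 + ecost m e2 + bitlen (eval m e1) + bitlen (eval m e2))%N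
  end.

Definition tcost (m : mem) (e : expr) : nat := (ecost m e + bitlen (eval m e))%N.

(* [exec c m m' w k]: started on registers [m], [c] halts with registers [m']
   after having written [w], at total cost [k]. *)
Inductive exec : cmd -> mem -> mem -> seq nat -> nat -> Prop :=
| exec_Skip m : exec Skip m m [::] 1
| exec_Assign e1 e2 m :
    exec (Assign e1 e2) m (upd m (eval m e1) (eval m e2)) [::]
      (tcost m e1 + tcost m e2)
| exec_Write e m : exec (Write e) m m [:: eval m e] (tcost m e)
| exec_Seq c1 c2 m m1 m2 w1 w2 k1 k2 :
    exec c1 m m1 w1 k1 -> exec c2 m1 m2 w2 k2 ->
    exec (Seq c1 c2) m m2 (w1 ++ w2) (k1 + k2)
| exec_IfT e c1 c2 m m1 w k :
    eval m e != 0%N -> exec c1 m m1 w k ->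
    exec (If e c1 c2) m m1 w (tcost m e + k)
| exec_IfF e c1 c2 m m1 w k :
    eval m e = 0%N -> exec c2 m m1 w k ->
    exec (If e c1 c2) m m1 w (tcost m e + k)
| exec_WhileT e c m m1 m2 w1 w2 k1 k2 :
    eval m e != 0%N -> exec c m m1 w1 k1 ->
    exec (While e c) m1 m2 w2 k2 ->
    exec (While e c) m m2 (w1 ++ w2) (tcost m e + k1 + k2)
| exec_WhileF e c m :
    eval m e = 0%N -> exec (While e c) m m [::] (tcost m e).

End Semantics.

(* On the input array [s], with all registers initially zero, the program
   outputs the bit sequence [w] in time [k]. *)
Definition outputs (p : cmd) (s : seq nat) (w : seq bool) (k : nat) : Prop :=
  exists m, exec (nth 0%N s) p (fun=> 0%N) m [seq nat_of_bool b | b <- w] k.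

Definition input_table n (T : gluing n) : seq nat :=
  n :: flatten [seq val (adj T t f) :: face_images T t f
               | t <- enum 'I_n, f <- enum 'I_4].

(* Main.v *)
(** A canonical labelling is determined by the tetrahedron labelled 0 and by the
    numbering of its vertices: scanning the faces in order, the next unlabelled
    tetrahedron met must get the next label, and condition (ii) forces the
    numbering of its vertices. Conversely this breadth-first search labels all
    tetrahedra, because the gluing graph is connected (a union of components would
    give a clopen subset of the realization), and its result is canonical. So the
    signature is the least of 24n encodings, all of length O(n log n). Since labels
    and vertices are written on fixed numbers of digits, the encodings compare like
    the tables of numbers, and a candidate is produced and compared with the best
    table so far in O(n) operations on numbers O(n), that is, in time O(n log n);
    only the best table is expanded into bits.

    The cost analysis is uniform: in a program made of [for] loops nested at depth
    [d], with all stored values at most [B], each loop runs at most [B] times and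
    each elementary operation costs O(log B), so the run costs O(B^d log B). Here
    [d = 2] and [B = 16n + 16]. *)

Require Import Defs.
From mathcomp Require Import all_boot all_order all_fingroup all_algebra.
From mathcomp Require Import all_classical all_reals all_analysis.
From mathcomp Require Import zify.
Set Implicit Arguments.
Unset Strict Implicit.
Unset Printing Implicit Defensive.
Import Order.TTheory GRing.Theory Num.Theory.
Import numFieldNormedType.Exports.
Local Open Scope nat_scope.

(** The machine offers only [while], addition and truncated subtraction, and charges every digit.
    Working on it directly would mix addresses, values and costs. The algorithm is therefore written
    in a language of named arrays and bounded loops, where a program denotes a function on stores,
    and is then compiled. Cost needs a single semantic fact, that no stored value exceeds [B]; the
    rest is read off the program text. The price is that every loop is charged [B] iterations, even
    the printing of a number, which takes O(log n). Nothing is lost, since printing also has depth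
    2; but a loop over the 4 faces or the 24 numberings would cost a factor [B], so these are
    unrolled. The term [16 * n] of [B] is the length of a table: n tetrahedra, 4 faces, 4 numbers
    per face. Program and search can be matched cell by cell because labels and numberings never
    change once given: the row of a face is final as soon as that face is explored. *)

(** * Loop programs and their cost *)

(* Names in [V] denote scalars, kept in entry 0. [Tet] maps labels to tetrahedra
   and [Lab] tetrahedra to their label plus one (0 if there is none yet); [Per] and
   [Ipr] hold the numberings of the vertices and their inverses, [Glue] the gluing
   permutations, [Pow] the powers of 2, [Cur] and [Best] two tables. *)
Inductive name : Type :=
  VN | VN4 | VN16 | VTwo | VW | Pow | Glue | Best | VStart | VI | VJ
| VT | VF | VU | VX | VY | VCnt | VCmp | Tet | Lab | Per | Ipr | Cur | Aux.

Definition code (a : name) : nat :=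
  match a with
  | VN => 0 | VN4 => 1 | VN16 => 2 | VTwo => 3 | VW => 4 | Pow => 5
  | Glue => 6 | Best => 7 | VStart => 8 | VI => 9 | VJ => 10 | VT => 11
  | VF => 12 | VU => 13 | VX => 14 | VY => 15 | VCnt => 16 | VCmp => 17
  | Tet => 18 | Lab => 19 | Per => 20 | Ipr => 21 | Cur => 22 | Aux => 23
  end.

Definition same (a b : name) : bool := code a == code b.

Inductive aexp : Type :=
| Lit of nat
| Inp of aexp
| Cell of name & aexp
| Quad of aexp
| Plus of aexp & aexp
| Minus of aexp & aexp.

Inductive prog : Type :=
| PSkip
| PSet of name & aexp & aexp
| POut of aexp
| PSeq of prog & prog
| PIf of aexp & prog & prog
| PFor of name & name & prog.

Definition store := name -> nat -> nat.

Definition put (s : store) (a : name) (i k : nat) : store :=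
  fun b j => if same b a && (j == i) then k else s b j.

Fixpoint writes (c : prog) (a : name) : bool :=
  match c with
  | PSkip | POut _ => false
  | PSet b _ _ => same a b
  | PSeq c1 c2 | PIf _ c1 c2 => writes c1 a || writes c2 a
  | PFor x _ c1 => same a x || writes c1 a
  end.

Fixpoint silent (c : prog) : bool :=
  match c with
  | PSkip | PSet _ _ _ => true
  | POut _ => false
  | PSeq c1 c2 | PIf _ c1 c2 => silent c1 && silent c2
  | PFor _ _ c1 => silent c1
  end.

(** A loop body changes neither its counter nor its bound, and these differ. The bound read on entry
    is then the number of iterations, so [iter] is faithful to a [while] that rereads both at each
    test. *)
Fixpoint wf (c : prog) : bool :=
  match c with
  | PSkip | PSet _ _ _ | POut _ => true
  | PSeq c1 c2 | PIf _ c1 c2 => wf c1 && wf c2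
  | PFor x y c1 => [&& ~~ same y x, ~~ writes c1 x, ~~ writes c1 y & wf c1]
  end.

Fixpoint depth (c : prog) : nat :=
  match c with
  | PSkip | PSet _ _ _ | POut _ => 0
  | PSeq c1 c2 | PIf _ c1 c2 => maxn (depth c1) (depth c2)
  | PFor _ _ c1 => (depth c1).+1
  end.

Fixpoint reads (e : aexp) (a : name) : bool :=
  match e with
  | Lit _ => false
  | Inp e1 | Quad e1 => reads e1 a
  | Cell b e1 => same a b || reads e1 a
  | Plus e1 e2 | Minus e1 e2 => reads e1 a || reads e2 a
  end.

Definition seqs (cs : seq prog) : prog := foldr PSeq PSkip cs.

(** * Meaning of loop programs, frame conditions and the loop rule *)

Section Denotation.
Variable inp : nat -> nat.

Fixpoint aeval (s : store) (e : aexp) : nat :=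
  match e with
  | Lit k => k
  | Inp e1 => inp (aeval s e1)
  | Cell a e1 => s a (aeval s e1)
  | Quad e1 => 4 * aeval s e1
  | Plus e1 e2 => aeval s e1 + aeval s e2
  | Minus e1 e2 => aeval s e1 - aeval s e2
  end.

Definition state := (store * seq nat)%type.

Definition incr (x : name) (f : state -> state) (s : state) : state :=
  (put (f s).1 x 0 ((f s).1 x 0).+1, (f s).2).

Fixpoint den (c : prog) (s : state) : state :=
  match c with
  | PSkip => s
  | PSet a e1 e2 => (put s.1 a (aeval s.1 e1) (aeval s.1 e2), s.2)
  | POut e => (s.1, rcons s.2 (aeval s.1 e))
  | PSeq c1 c2 => den c2 (den c1 s)
  | PIf e c1 c2 => if aeval s.1 e != 0 then den c1 s else den c2 s
  | PFor x y c1 => iter (s.1 y 0) (incr x (den c1)) (put s.1 x 0 0, s.2)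
  end.

(* During the run, all stored values are at most [B]. *)
Fixpoint safe (B : nat) (c : prog) (s : state) : Prop :=
  match c with
  | PSkip | POut _ => True
  | PSet _ _ e2 => aeval s.1 e2 <= B
  | PSeq c1 c2 => safe B c1 s /\ safe B c2 (den c1 s)
  | PIf e c1 c2 => if aeval s.1 e != 0 then safe B c1 s else safe B c2 s
  | PFor x y c1 => forall k, k < s.1 y 0 ->
      safe B c1 (iter k (incr x (den c1)) (put s.1 x 0 0, s.2))
  end.

Lemma same_sym a b : same a b = same b a.
Proof. exact: eq_sym. Qed.



Lemma put_neq s a i k b : ~~ same b a -> put s a i k b = s b.
Proof. by move=> /negbTE h; apply/funext => j; rewrite /put h. Qed.

Lemma iter_frame c x k s a : ~~ same a x ->
  (forall s, (den c s).1 a = s.1 a) ->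
  (iter k (incr x (den c)) s).1 a = s.1 a.
Proof.
by move=> ax h; elim: k => //= k IH; rewrite put_neq // h.
Qed.

(** As [writes] is computed from the text, frame conditions on concrete programs hold by
    evaluation. *)
Lemma den_frame c s a : ~~ writes c a -> (den c s).1 a = s.1 a.
Proof.
elim: c s => //= [b e1 e2|c1 IH1 c2 IH2|e c1 IH1 c2 IH2|x y c IH] s.
- exact: put_neq.
- by rewrite negb_or => /andP[h1 h2]; rewrite IH2 // IH1.
- by rewrite negb_or => /andP[h1 h2]; case: ifP => _; [rewrite IH1|rewrite IH2].
- rewrite negb_or => /andP[h1 h2]; rewrite iter_frame //=; last by move=> t; exact: IH.
  by rewrite put_neq.
Qed.

Lemma den_silent c s : silent c -> (den c s).2 = s.2.
Proof.
elim: c s => //= [c1 IH1 c2 IH2|e c1 IH1 c2 IH2|x y c IH] s.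
- by case/andP=> h1 h2; rewrite IH2 // IH1.
- by case/andP=> h1 h2; case: ifP => _; [rewrite IH1|rewrite IH2].
- by move=> h; elim: (s.1 y 0) => //= k IHk; rewrite IH.
Qed.

Lemma iter_counter x c s k : ~~ writes c x ->
  (iter k (incr x (den c)) (put s.1 x 0 0, s.2)).1 x 0 = k.
Proof.
move=> cx; elim: k => /= [|k IH]; first by rewrite /put /same !eqxx.
by rewrite /put /same !eqxx /= den_frame // IH.
Qed.

(* The invariant of a loop; the frame conditions on the counter and on the bound
   are supplied by well-formedness. *)
Lemma for_spec B x y c (s : state) (I : nat -> state -> Prop) :
  wf (PFor x y c) ->
  I 0 (put s.1 x 0 0, s.2) ->
  (forall k t, k < s.1 y 0 -> t.1 x 0 = k ->
     (forall a, ~~ writes (PFor x y c) a -> t.1 a = s.1 a) -> I k t ->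
     safe B c t /\ I k.+1 (put (den c t).1 x 0 k.+1, (den c t).2)) ->
  safe B (PFor x y c) s /\ I (s.1 y 0) (den (PFor x y c) s).
Proof.
move=> /= /and4P[yx cx cy wfc] I0 IS.
set F := incr x (den c); set s0 := (put s.1 x 0 0, s.2).
have hfr k a : ~~ writes (PFor x y c) a -> (iter k F s0).1 a = s.1 a.
  rewrite /= negb_or => /andP[ax ca].
  by rewrite iter_frame //= ?put_neq // => t; exact: den_frame.
have hI k : k <= s.1 y 0 -> I k (iter k F s0).
  elim: k => // k IH kN /=.
  have [_] := IS k _ kN (iter_counter s k cx) (hfr k) (IH (ltnW kN)).
  by rewrite [in X in _ -> X]/F /incr -/F den_frame // iter_counter.
split; last exact: hI.
by move=> k kN; case: (IS k _ kN (iter_counter s k cx) (hfr k) (hI k (ltnW kN))).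
Qed.

Lemma den_cons c cs s : den (seqs (c :: cs)) s = den (seqs cs) (den c s).
Proof. by []. Qed.

Lemma safe_cons B c cs s :
  safe B c s -> safe B (seqs cs) (den c s) -> safe B (seqs (c :: cs)) s.
Proof. by []. Qed.

(* Stated for fixed lengths, so that rewriting does not unfold the items. *)
Lemma den_seqs3 c1 c2 c3 s : den (seqs [:: c1; c2; c3]) s = den c3 (den c2 (den c1 s)).
Proof. by []. Qed.

Lemma den_seqs4 c1 c2 c3 c4 s :
  den (seqs [:: c1; c2; c3; c4]) s = den c4 (den c3 (den c2 (den c1 s))).
Proof. by []. Qed.

Lemma den_seqs5 c1 c2 c3 c4 c5 s :
  den (seqs [:: c1; c2; c3; c4; c5]) s = den c5 (den c4 (den c3 (den c2 (den c1 s)))).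
Proof. by []. Qed.

Lemma safe_seqs3 B c1 c2 c3 s : safe B c1 s -> safe B c2 (den c1 s) ->
  safe B c3 (den c2 (den c1 s)) -> safe B (seqs [:: c1; c2; c3]) s.
Proof. by []. Qed.

Lemma safe_seqs4 B c1 c2 c3 c4 s : safe B c1 s -> safe B c2 (den c1 s) ->
  safe B c3 (den c2 (den c1 s)) -> safe B c4 (den c3 (den c2 (den c1 s))) ->
  safe B (seqs [:: c1; c2; c3; c4]) s.
Proof. by []. Qed.

Lemma safe_seqs5 B c1 c2 c3 c4 c5 s : safe B c1 s -> safe B c2 (den c1 s) ->
  safe B c3 (den c2 (den c1 s)) -> safe B c4 (den c3 (den c2 (den c1 s))) ->
  safe B c5 (den c4 (den c3 (den c2 (den c1 s)))) ->
  safe B (seqs [:: c1; c2; c3; c4; c5]) s.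
Proof. by []. Qed.

Lemma den_if e c1 c2 s :
  den (PIf e c1 c2) s = if aeval s.1 e != 0 then den c1 s else den c2 s.
Proof. by []. Qed.

Lemma safe_if B e c1 c2 s :
  safe B (PIf e c1 c2) s = if aeval s.1 e != 0 then safe B c1 s else safe B c2 s.
Proof. by []. Qed.


Lemma aeval_put s a i k e : ~~ reads e a -> aeval (put s a i k) e = aeval s e.
Proof.
elim: e => //= [e IH|b e IH|e IH|e1 IH1 e2 IH2|e1 IH1 e2 IH2].
- by move/IH ->.
- by rewrite negb_or => /andP[ab /IH ->]; rewrite put_neq // same_sym.
- by move/IH ->.
- by rewrite negb_or => /andP[/IH1 -> /IH2 ->].
- by rewrite negb_or => /andP[/IH1 -> /IH2 ->].
Qed.

Definition fill (a : name) (e1 e2 : nat -> aexp) (l : seq nat) : prog :=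
  seqs [seq PSet a (e1 c) (e2 c) | c <- l].

(** No expression reads the array being filled, so all of them may be evaluated in the initial
    store; equal addresses receive equal values, so the order of the assignments does not matter. *)
Lemma fill_spec B a e1 e2 l (s : state) :
  (forall c, ~~ reads (e1 c) a && ~~ reads (e2 c) a) ->
  (forall c, c \in l -> aeval s.1 (e2 c) <= B) ->
  (forall c c', c \in l -> c' \in l -> aeval s.1 (e1 c) = aeval s.1 (e1 c') ->
     aeval s.1 (e2 c) = aeval s.1 (e2 c')) ->
  [/\ safe B (fill a e1 e2 l) s,
      forall c, c \in l ->
        (den (fill a e1 e2 l) s).1 a (aeval s.1 (e1 c)) = aeval s.1 (e2 c)
    & forall j, (forall c, c \in l -> j <> aeval s.1 (e1 c)) ->
        (den (fill a e1 e2 l) s).1 a j = s.1 a j].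
Proof.
move=> rd; elim: l s => [|c l IH] s bd inj; first by split.
rewrite /fill /= -/(fill a e1 e2 l).
set s1 := (put _ _ _ _, _).
have E1 c' : aeval s1.1 (e1 c') = aeval s.1 (e1 c').
  by apply: aeval_put; case/andP: (rd c').
have E2 c' : aeval s1.1 (e2 c') = aeval s.1 (e2 c').
  by apply: aeval_put; case/andP: (rd c').
have [|c' c'' cl cl'|sf hin hout] := IH s1.
- by move=> c' cl; rewrite E2 bd // inE cl orbT.
- by rewrite !E1 !E2; apply: inj; rewrite inE ?cl ?cl' orbT.
split=> [|c'|j hj]; first by split => //; apply: bd; rewrite inE eqxx.
(* Either a later assignment hits the same address, and writes the same value, or this cell is left
   alone by the rest of the list. *)
- have [/hasP[c'' cl /eqP e]|/hasPn no] := boolP (has (fun c'' => aeval s.1 (e1 c'') == aeval s.1 (e1 c')) l).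
    move=> cc; have := hin _ cl; rewrite E1 E2 e => ->.
    by apply: inj => //; rewrite inE cl orbT.
  rewrite inE => /orP[/eqP cc|cl]; last by have /= := no _ cl; rewrite eqxx.
  rewrite hout => [|c'' cl]; last by rewrite E1 => e; have /= := no _ cl; rewrite e eqxx.
  by rewrite /s1 /= /put /same cc !eqxx.
- rewrite hout => [|c' cl]; last by rewrite E1; apply: hj; rewrite inE cl orbT.
  rewrite /s1 /= /put /same eqxx /=; case: eqP => // e.
  by case: (hj c); rewrite ?inE ?eqxx.
Qed.

End Denotation.

Lemma writes_seqs cs a : writes (seqs cs) a = has (fun c => writes c a) cs.
Proof. by elim: cs => //= c cs ->. Qed.

Lemma silent_seqs cs : silent (seqs cs) = all silent cs.
Proof. by elim: cs => //= c cs ->. Qed.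

Lemma wf_seqs cs : wf (seqs cs) = all wf cs.
Proof. by elim: cs => //= c cs ->. Qed.

Lemma depth_seqs d cs : (depth (seqs cs) <= d) = all (fun c => depth c <= d) cs.
Proof. by elim: cs => //= c cs <-; rewrite geq_max. Qed.

(** * Compilation to the machine and its cost *)

(** A power of two above the 24 codes: the arrays are interleaved, and without multiplication an
    address is still formed by five doublings. *)
Definition stride := 32.

(** The expression is duplicated, and evaluated twice; this affects only the constant factor of the
    cost. *)
Definition double (e : expr) : expr := Add e e.

Fixpoint compile_exp (e : aexp) : expr :=
  match e with
  | Lit k => Const k
  | Inp e1 => Input (compile_exp e1)
  | Cell a e1 => Reg (Add (iter 5 double (compile_exp e1)) (Const (code a)))
  | Quad e1 => double (double (compile_exp e1))
  | Plus e1 e2 => Add (compile_exp e1) (compile_exp e2)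
  | Minus e1 e2 => Defs.Sub (compile_exp e1) (compile_exp e2)
  end.

Definition address (a : name) (e : aexp) : expr :=
  Add (iter 5 double (compile_exp e)) (Const (code a)).

Fixpoint compile (c : prog) : cmd :=
  match c with
  | PSkip => Skip
  | PSet a e1 e2 => Assign (address a e1) (compile_exp e2)
  | POut e => Write (compile_exp e)
  | PSeq c1 c2 => Seq (compile c1) (compile c2)
  | PIf e c1 c2 => If (compile_exp e) (compile c1) (compile c2)
  | PFor x y c1 =>
      Seq (Assign (address x (Lit 0)) (Const 0))
          (While (Defs.Sub (compile_exp (Cell y (Lit 0))) (compile_exp (Cell x (Lit 0))))
                 (Seq (compile c1)
                      (Assign (address x (Lit 0))
                              (Add (compile_exp (Cell x (Lit 0))) (Const 1)))))
  end.

(* If all registers and inputs are at most [B >= 1], an expression [e] has value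
   at most [esize e * B]. *)
Fixpoint esize (e : expr) : nat :=
  match e with
  | Const k => k.+1
  | Input e1 | Reg e1 => (esize e1).+1
  | Add e1 e2 | Defs.Sub e1 e2 => esize e1 + esize e2
  end.

(** Costs are counted in units of [bitlen B]. A value at most [a * B] has at most
    [bitlen a + bitlen B] digits, hence at most [(bitlen a).+1] units, which explains the
    successors. *)
Fixpoint ecoef (e : expr) : nat :=
  match e with
  | Const k => bitlen k
  | Input e1 | Reg e1 => ecoef e1 + (bitlen (esize e1)).+1 + (bitlen (esize e)).+1
  | Add e1 e2 | Defs.Sub e1 e2 =>
      ecoef e1 + ecoef e2 + (bitlen (esize e1)).+1 + (bitlen (esize e2)).+1
  end.

Definition tcoef (e : expr) : nat := ecoef e + (bitlen (esize e)).+1.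

(** Subtraction is truncated, so the test is nonzero exactly while the counter is below the
    bound. *)
Definition for_test (x y : name) : expr :=
  Defs.Sub (compile_exp (Cell y (Lit 0))) (compile_exp (Cell x (Lit 0))).
Definition for_next (x : name) : nat :=
  tcoef (address x (Lit 0)) + tcoef (Add (compile_exp (Cell x (Lit 0))) (Const 1)).

(** The constant [C] in the cost [C * B ^ depth c * bitlen B]. For a loop, the first line is paid
    once (initialisation and the final, failing test), the second once per iteration. *)
Fixpoint coef (c : prog) : nat :=
  match c with
  | PSkip => 1
  | PSet a e1 e2 => tcoef (address a e1) + tcoef (compile_exp e2)
  | POut e => tcoef (compile_exp e)
  | PSeq c1 c2 => coef c1 + coef c2
  | PIf e c1 c2 => tcoef (compile_exp e) + (coef c1 + coef c2)
  | PFor x y c1 =>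
      tcoef (address x (Lit 0)) + tcoef (Const 0) + tcoef (for_test x y)
      + (tcoef (for_test x y) + (coef c1 + for_next x))
  end.

Lemma bitlen_gt0 k : 0 < bitlen k.
Proof. by []. Qed.

Lemma leq_bitlen j k : j <= k -> bitlen j <= bitlen k.
Proof. by move=> h; rewrite ltnS leq_trunc_log. Qed.

Lemma ltn_bitlen k : k < 2 ^ bitlen k.
Proof. by case: k => // k; exact: trunc_log_ltn. Qed.

Lemma bitlen_ltn k w : 0 < w -> k < 2 ^ w -> bitlen k <= w.
Proof.
case: k => [|k] w0 h; first by rewrite /bitlen trunc_log0.
by rewrite /bitlen -(ltn_exp2l _ _ (isT : 1 < 2)) (leq_ltn_trans _ h) // trunc_logP.
Qed.

Lemma bitlenM a k : bitlen (a * k) <= bitlen a + bitlen k.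
Proof.
apply: bitlen_ltn => //; rewrite expnD.
by apply: leq_ltn_trans (_ : (2 ^ bitlen a).-1 * (2 ^ bitlen k) < _);
  [rewrite leq_mul // ?(ltnW (ltn_bitlen k)) // -ltnS prednK ?expn_gt0 // ltn_bitlen
  |rewrite ltn_pmul2r ?expn_gt0 // prednK ?expn_gt0].
Qed.

Section Cost.
Variables (inp : Defs.mem) (B : nat).
Hypotheses (B0 : 0 < B) (inpB : forall i, inp i <= B).

Definition bounded (m : Defs.mem) : Prop := forall a, m a <= B.

Let L := bitlen B.

Lemma eval_bound m e : bounded m -> Defs.eval inp m e <= esize e * B.
Proof.
move=> mB; elim: e => /= [k|e IH|e IH|e1 IH1 e2 IH2|e1 IH1 e2 IH2].
- by rewrite (leq_trans (leqnSn k)) // leq_pmulr.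
- by rewrite (leq_trans (inpB _)) // leq_pmull.
- by rewrite (leq_trans (mB _)) // leq_pmull.
- by rewrite mulnDl leq_add.
- by rewrite (leq_trans (leq_subr _ _)) // (leq_trans IH1) // leq_mul // leq_addr.
Qed.

Lemma bitlen_eval m e : bounded m -> bitlen (Defs.eval inp m e) <= (bitlen (esize e)).+1 * L.
Proof.
move=> mB; apply: leq_trans (leq_bitlen (eval_bound e mB)) _.
by apply: leq_trans (bitlenM _ _) _; rewrite mulSn addnC leq_add2l leq_pmulr.
Qed.

Lemma ecost_bound m e : bounded m -> ecost inp m e <= ecoef e * L.
Proof.
move=> mB.
elim: e => [k|e IH|e IH|e1 IH1 e2 IH2|e1 IH1 e2 IH2].
- by rewrite /= leq_pmulr.
- have := bitlen_eval (Input e) mB; have := bitlen_eval e mB.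
  by rewrite [ecoef _]/= [ecost _ _ _]/= => h1 h2; rewrite !mulnDl !leq_add.
- have := bitlen_eval (Reg e) mB; have := bitlen_eval e mB.
  by rewrite [ecoef _]/= [ecost _ _ _]/= => h1 h2; rewrite !mulnDl !leq_add.
- have := bitlen_eval e1 mB; have := bitlen_eval e2 mB.
  by rewrite /= => h1 h2; rewrite !mulnDl !leq_add.
- have := bitlen_eval e1 mB; have := bitlen_eval e2 mB.
  by rewrite /= => h1 h2; rewrite !mulnDl !leq_add.
Qed.

Lemma tcost_bound m e : bounded m -> tcost inp m e <= tcoef e * L.
Proof.
by move=> mB; rewrite /tcost mulnDl leq_add ?ecost_bound ?bitlen_eval.
Qed.

(* Entry [i] of array [a] is register [stride * i + code a]. *)
Definition represents (m : Defs.mem) (s : store) : Prop :=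
  forall a i, m (stride * i + code a) = s a i.

Lemma eval_double m e k : Defs.eval inp m (iter k double e) = 2 ^ k * Defs.eval inp m e.
Proof. by elim: k => [|k IH] /=; rewrite ?mul1n // IH expnS -mulnA mul2n addnn. Qed.

Lemma eval_compile m s e : represents m s -> Defs.eval inp m (compile_exp e) = aeval inp s e.
Proof.
move=> ms; elim: e => [k|e IH|a e IH|e IH|e1 IH1 e2 IH2|e1 IH1 e2 IH2] //=.
- by rewrite IH.
- rewrite -(ms a) -IH -[in RHS](eval_double m _ 5) /=; congr (m _); lia.
- by rewrite IH; lia.
- by rewrite IH1 IH2.
- by rewrite IH1 IH2.
Qed.

Lemma eval_address m s a e : represents m s ->
  Defs.eval inp m (address a e) = stride * aeval inp s e + code a.
Proof. by move=> ms; rewrite -(eval_compile e ms) [LHS]/= /stride; lia. Qed.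

Lemma code_lt a : code a < stride.
Proof. by case: a. Qed.

(** Codes are below [stride], so by division with remainder an address determines both the array and
    the entry. *)
Lemma represents_upd m s a i k : represents m s ->
  represents (upd m (stride * i + code a) k) (put s a i k).
Proof.
move=> ms b j; rewrite /upd /put /same ms.
suff -> : (stride * j + code b == stride * i + code a)
          = (code b == code a) && (j == i) by [].
have := code_lt a; have := code_lt b; rewrite /stride.
by case: eqP; case: eqP; case: eqP => //=; lia.
Qed.

Lemma bounded_upd m a k : bounded m -> k <= B -> bounded (upd m a k).
Proof. by move=> mB kB b; rewrite /upd; case: ifP. Qed.

Lemma set_exec m s a e1 e2 : represents m s -> bounded m -> aeval inp s e2 <= B ->
  exists m' k, [/\ exec inp (Assign (address a e1) (compile_exp e2)) m m' [::] k,
    represents m' (put s a (aeval inp s e1) (aeval inp s e2)), bounded m'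
    & k <= (tcoef (address a e1) + tcoef (compile_exp e2)) * L].
Proof.
move=> ms mB eB.
eexists; eexists; split; first exact: exec_Assign.
- by rewrite (eval_address _ _ ms) (eval_compile _ ms); exact: represents_upd.
- by apply: bounded_upd => //; rewrite (eval_compile _ ms).
- by rewrite mulnDl leq_add // tcost_bound.
Qed.

Definition simulates (c : prog) (cost : nat) (s : state) : Prop :=
  forall m, represents m s.1 -> bounded m ->
  exists m' k w, [/\ exec inp (compile c) m m' w k,
    represents m' (den inp c s).1, bounded m', (den inp c s).2 = s.2 ++ w
    & k <= cost].

(** The cost [C] of the body is assumed for all safe states at once, so that it can be multiplied by
    the number of iterations. *)
Lemma for_exec x y c (s : state) C :
  wf (PFor x y c) -> safe inp B (PFor x y c) s ->
  (forall t, safe inp B c t -> simulates c C t) ->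
  simulates (PFor x y c) ((tcoef (address x (Lit 0)) + tcoef (Const 0)) * L
     + s.1 y 0 * (tcoef (for_test x y) * L + (C + for_next x * L))
     + tcoef (for_test x y) * L) s.
Proof.
move=> wfc sf simc m ms mB.
(* The loop bound is itself a stored value. This limits both the number of iterations and the
   counter, which is why [safe] need not mention counters. *)
have yB : s.1 y 0 <= B by rewrite -ms.
case/and4P: wfc => yx cx cy _.
set N := s.1 y 0 in yB *.
set F := incr x (den inp c); set s0 : state := (put s.1 x 0 0, s.2).
have hy k : (iter k F s0).1 y 0 = N.
  by rewrite iter_frame //= ?put_neq // => t; exact: den_frame.
have hx k : (iter k F s0).1 x 0 = k by exact: iter_counter.
pose D := tcoef (for_test x y) * L + (C + for_next x * L).
(* Induction on the number [j] of iterations still to come, as an execution of [While] is built from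
   its end. *)
have loop j : j <= N -> forall m, represents m (iter (N - j) F s0).1 -> bounded m ->
    exists m' k w, [/\ exec inp (While (for_test x y) (Seq (compile c)
         (Assign (address x (Lit 0)) (Add (compile_exp (Cell x (Lit 0))) (Const 1)))))
         m m' w k,
      represents m' (iter N F s0).1, bounded m',
      (iter N F s0).2 = (iter (N - j) F s0).2 ++ w
      & k <= j * D + tcoef (for_test x y) * L].
  elim: j => [|j IH] jN {m ms mB} m ms mB.
    rewrite subn0 in ms *.
    exists m, (tcost inp m (for_test x y)), [::]; rewrite cats0; split => //.
      apply: exec_WhileF; rewrite [LHS]/=; have /= -> := eval_compile (Cell y (Lit 0)) ms.
      by have /= -> := eval_compile (Cell x (Lit 0)) ms; rewrite hx hy subnn.
    exact: tcost_bound.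
  have jS : N - j = (N - j.+1).+1 by rewrite subnS prednK // subn_gt0.
  set t := iter (N - j.+1) F s0 in ms.
  have st : safe inp B c t by apply: sf; rewrite ltn_subrL /= (leq_trans _ jN).
  have [m1 [k1 [w1 [e1 r1 b1 o1 c1]]]] := simc t st m ms mB.
  have x1 : aeval inp (den inp c t).1 (Plus (Cell x (Lit 0)) (Lit 1)) <= B.
    rewrite /= den_frame // hx; lia.
  have [m2 [k2 [e2 r2 b2 c2]]] := set_exec x (Lit 0) r1 b1 x1.
  have F_t : iter (N - j) F s0 = (put (den inp c t).1 x 0 (N - j.+1).+1, (den inp c t).2).
    by rewrite jS /= -/t /F /incr /= den_frame // hx.
  have r2' : represents m2 (iter (N - j) F s0).1.
    by rewrite F_t; move: r2; rewrite /= den_frame // hx addn1.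
  have [m3 [k3 [w3 [e3 r3 b3 o3 c3]]]] := IH (ltnW jN) _ r2' b2.
  exists m3, (tcost inp m (for_test x y) + (k1 + k2) + k3), ((w1 ++ [::]) ++ w3).
  split => //; last 1 first.
  - have -> : j.+1 * D + tcoef (for_test x y) * L
      = tcoef (for_test x y) * L + (C + for_next x * L) + (j * D + tcoef (for_test x y) * L).
      by rewrite mulSn /D -!addnA.
    apply: leq_add; last exact: c3.
    by apply: leq_add; [exact: tcost_bound | exact: leq_add c1 c2].
  - apply: exec_WhileT e3; last exact: exec_Seq e1 e2.
    rewrite [Defs.eval _ _ _]/=; have /= -> := eval_compile (Cell y (Lit 0)) ms.
    have /= -> := eval_compile (Cell x (Lit 0)) ms; rewrite hx hy; lia.
  - by rewrite o3 F_t /= o1 cats0 catA.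
have z0 : aeval inp s.1 (Lit 0) <= B by [].
have [m1 [k1 [e1 r1 b1 c1]]] := set_exec x (Lit 0) ms mB z0.
have r1' : represents m1 (iter (N - N) F s0).1 by rewrite subnn.
have [m2 [k2 [w2 [e2 r2 b2 o2 c2]]]] := loop N (leqnn N) m1 r1' b1.
exists m2, (k1 + k2), ([::] ++ w2); split => //; last 1 first.
- by rewrite -addnA; apply: leq_add c1 _; exact: c2.
- exact: exec_Seq e1 e2.
- by rewrite [LHS]o2 subnn.
Qed.

Lemma compile_correct c s : wf c -> safe inp B c s ->
  simulates c (coef c * B ^ depth c * L) s.
Proof.
have le1 k d : k <= k * B ^ d by rewrite leq_pmulr // expn_gt0 B0.
have leB k d d' : d <= d' -> k * B ^ d <= k * B ^ d'.
  by move=> dd; rewrite leq_mul // leq_pexp2l.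
elim: c s => [|a e1 e2|e|c1 IH1 c2 IH2|e c1 IH1 c2 IH2|x y c IH] s wfc sf.
- move=> m ms mB; exists m, 1, [::]; split => //; first exact: exec_Skip.
  + by rewrite cats0.
- move=> m ms mB; have [m' [k [h1 h2 h3 h4]]] := set_exec a e1 ms mB sf.
  by exists m', k, [::]; split => //; rewrite ?cats0 //= muln1.
- move=> m ms mB; exists m, (tcost inp m (compile_exp e)).
  exists [:: Defs.eval inp m (compile_exp e)]; split => //; first exact: exec_Write.
  + by rewrite (eval_compile _ ms) /= cats1.
  + by rewrite /= muln1 tcost_bound.
- move=> m ms mB; case/andP: wfc => wf1 wf2; case: sf => sf1 sf2.
  have [m1 [k1 [w1 [x1 r1 b1 o1 l1]]]] := IH1 s wf1 sf1 m ms mB.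
  have [m2 [k2 [w2 [x2 r2 b2 o2 l2]]]] := IH2 _ wf2 sf2 m1 r1 b1.
  exists m2, (k1 + k2), (w1 ++ w2); split => //; first exact: exec_Seq x1 x2.
  + by rewrite /= o2 o1 catA.
  + rewrite /= !mulnDl leq_add //.
      by apply: leq_trans l1 _; rewrite leq_mul // leB // leq_maxl.
    by apply: leq_trans l2 _; rewrite leq_mul // leB // leq_maxr.
- move=> m ms mB; case/andP: wfc => wf1 wf2.
  have ev := eval_compile e ms.
  have tc := tcost_bound (compile_exp e) mB.
  move: sf; rewrite /=; case: ifP => [ne|/negbFE/eqP ne] sf.
  + have [m1 [k1 [w1 [x1 r1 b1 o1 l1]]]] := IH1 s wf1 sf m ms mB.
    exists m1, (tcost inp m (compile_exp e) + k1), w1; split => //.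
      by apply: exec_IfT x1; rewrite ev.
    rewrite /= 2!mulnDl leq_add //; first by apply: leq_trans tc _; rewrite leq_mul.
    by apply: leq_trans l1 _; rewrite leq_mul // leq_mul ?leq_addr // leq_pexp2l // leq_maxl.
  + have [m1 [k1 [w1 [x1 r1 b1 o1 l1]]]] := IH2 s wf2 sf m ms mB.
    exists m1, (tcost inp m (compile_exp e) + k1), w1; split => //.
      by apply: exec_IfF x1; rewrite ev.
    rewrite /= 2!mulnDl leq_add //; first by apply: leq_trans tc _; rewrite leq_mul.
    by apply: leq_trans l1 _; rewrite leq_mul // leq_mul ?leq_addl // leq_pexp2l // leq_maxr.
- have wfb : wf c by case/and4P: wfc.
  move=> m ms mB.
  have [m' [k [w [h1 h2 h3 h4 h5]]]] :=
    for_exec wfc sf (fun t => IH t wfb) ms mB.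
  exists m', k, w; split => //; apply: leq_trans h5 _.
  have yB : s.1 y 0 <= B by rewrite -ms.
  rewrite [coef (PFor _ _ _)]/= [depth (PFor _ _ _)]/= expnS.
  set a := tcoef _ + tcoef _; set b := tcoef _; set d := for_next x.
  have P0 : 0 < B ^ depth c by rewrite expn_gt0 B0.
  set e := coef c; set P := B ^ depth c in P0 *; set N := s.1 y 0 in yB *.
  clearbody a b d e N P.
  have g1 : (a + b) * L <= (a + b) * (B * P * L).
    by rewrite leq_mul2l leq_pmull ?orbT // muln_gt0 B0.
  have g2 : N * (b * L + (e * P * L + d * L)) <= (b + (e + d)) * (B * P * L).
    apply: leq_trans (leq_mul yB (leqnn _)) _.
    have -> : (b + (e + d)) * (B * P * L) = B * (b * (P * L) + (e * P * L + d * (P * L))) by lia.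
    by rewrite leq_mul2l leq_add ?orbT ?leq_add // leq_mul2l leq_pmull ?orbT.
  apply: leq_trans (_ : (a + b) * L + N * (b * L + (e * P * L + d * L)) <= _).
    by rewrite mulnDl addnAC.
  apply: leq_trans (leq_add g1 g2) _.
  by rewrite -mulnDl mulnA.
Qed.

End Cost.

(** * Canonical labellings and breadth-first search *)

Lemma nth_flatten_const (A : Type) (x0 : A) (c : nat) (ss : seq (seq A)) i j :
  all (fun s => size s == c) ss -> j < c -> i < size ss ->
  nth x0 (flatten ss) (c * i + j) = nth x0 (nth [::] ss i) j.
Proof.
elim: ss i => //= s ss IH [|i] /andP[/eqP sc allc] jc; rewrite nth_cat sc.
  by rewrite muln0 jc.
by rewrite mulnS -addnA [c + _ < c]ltnNge leq_addr addKn ltnS /= => /IH ->.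
Qed.

Lemma size_flatten_const (A : Type) (c : nat) (ss : seq (seq A)) :
  all (fun s => size s == c) ss -> size (flatten ss) = c * size ss.
Proof.
elim: ss => [|s ss IH] /=; first by rewrite muln0.
by case/andP=> /eqP sc /IH h; rewrite size_cat sc mulnS h.
Qed.

Lemma nth_allpairs_ord (A : Type) (x0 : A) n c (F : 'I_n -> 'I_c -> A) (i : 'I_n) (j : 'I_c) :
  nth x0 [seq F t f | t <- enum 'I_n, f <- enum 'I_c] (c * i + j) = F i j.
Proof.
rewrite nth_flatten_const //; last by rewrite size_map size_enum_ord.
  rewrite (nth_map i) ?size_enum_ord // (nth_map j) ?size_enum_ord //.
  by rewrite !nth_ord_enum.
by rewrite all_map; apply/allP => t _ /=; rewrite size_map size_enum_ord.
Qed.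

Lemma size_allpairs_ord (A : Type) n c (F : 'I_n -> 'I_c -> A) :
  size [seq F t f | t <- enum 'I_n, f <- enum 'I_c] = n * c.
Proof. by rewrite size_allpairs !size_enum_ord. Qed.

Lemma index_leq (A : eqType) (x0 x : A) s k : k < size s -> nth x0 s k = x -> index x s <= k.
Proof.
move=> ks sk; rewrite leqNgt; apply/negP => /(before_find x0) /=.
by rewrite sk eqxx.
Qed.

(** Stated through sets closed under adjacency, since both uses produce one: the clopen sets of the
    realization, and a search queue with nothing left to explore. *)
Definition face_connected n (T : gluing n) : Prop :=
  forall C : {set 'I_n}, (exists t, t \in C) ->
  (forall t f, t \in C -> adj T t f \in C) -> forall t, t \in C.

Section AdjSeq.
Variables (n : nat) (T : gluing n).

Lemma size_adj_seq : size (adj_seq T) = n * 4.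
Proof. exact: size_allpairs_ord. Qed.

Lemma nth_adj_seq x0 (t : 'I_n) (f : 'I_4) : nth x0 (adj_seq T) (4 * t + f) = adj T t f.
Proof. exact: nth_allpairs_ord. Qed.

End AdjSeq.

(** * The breadth-first search and its canonical labelling *)

Section Bfs.
Variables (n : nat) (T : gluing n) (t0 : 'I_n) (p : 'S_4).

Definition face (k : nat) : 'I_4 := inord (k %% 4).

Definition bstate := (seq 'I_n * {ffun 'I_n -> 'S_4})%type.

(** The default [t0] would be read only if the queue ran dry, which [bfs_size_gt] excludes for
    [k < 4 * n]. *)
Definition btet (s : bstate) (k : nat) : 'I_n := nth t0 s.1 (k %/ 4).
Definition bface (s : bstate) (k : nat) : 'I_4 := (s.2 (btet s k))^-1%g (face k).
Definition btarget (s : bstate) (k : nat) : 'I_n := adj T (btet s k) (bface s k).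

(** The numbering of the new tetrahedron is the solution [q] of [(s.2 t)^-1 * gmap T t (bface s k) *
    q = 1]: the relabelled gluing must be the identity. *)
Definition bstep (s : bstate) (k : nat) : bstate :=
  let t := btet s k in
  let u := btarget s k in
  if u \in s.1 then s
  else (rcons s.1 u,
        [ffun x => if x == u then ((gmap T t (bface s k))^-1 * s.2 t)%g else s.2 x]).

(* After [k = 4 * i + f] steps, faces [0, ..., f-1] of the tetrahedron labelled
   [i], and all faces of those with smaller labels, have been explored. *)
Fixpoint bfs (k : nat) : bstate :=
  if k is j.+1 then bstep (bfs j) j else ([:: t0], [ffun=> p]).

Local Notation q k := (bfs k).1.
Local Notation P k := (bfs k).2.
Local Notation u k := (btarget (bfs k) k).

Lemma bfs_uniq k : uniq (q k).
Proof.
by elim: k => //= k IH; rewrite /bstep; case: ifP => // h; rewrite rcons_uniq h.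
Qed.

Lemma bfs_prefix j k : j <= k -> exists s, q k = q j ++ s.
Proof.
move=> /subnK <-; elim: (k - j) => [|d [s qs]]; first by exists [::]; rewrite cats0.
rewrite addSn /= /bstep; case: ifP => _; first by exists s.
by exists (rcons s (u (d + j))); rewrite /= qs rcons_cat.
Qed.

Lemma bfs_mem j k x : j <= k -> x \in q j -> x \in q k.
Proof. by move=> /bfs_prefix[s ->] xj; rewrite mem_cat xj. Qed.

Lemma bfs_index j k x : j <= k -> x \in q j -> index x (q k) = index x (q j).
Proof. by move=> /bfs_prefix[s ->] xj; rewrite index_cat xj. Qed.

Lemma bfs_nth j k i : j <= k -> i < size (q j) -> nth t0 (q k) i = nth t0 (q j) i.
Proof. by move=> /bfs_prefix[s ->] ij; rewrite nth_cat ij. Qed.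

Lemma bfs_size j k : j <= k -> size (q j) <= size (q k).
Proof. by move=> /bfs_prefix[s ->]; rewrite size_cat leq_addr. Qed.

Lemma bfs_size0 k : 0 < size (q k).
Proof. exact: (bfs_size (leq0n k)). Qed.

Lemma bfs_nth0 k : nth t0 (q k) 0 = t0.
Proof. by rewrite (bfs_nth (leq0n k)). Qed.

Lemma bfs_perm j k x : j <= k -> x \in q j -> P k x = P j x.
Proof.
move=> /subnK <- xj; elim: (k - j) => //= d IH; rewrite /bstep; case: ifP => // uq.
rewrite /= ffunE; case: eqP => // xu; rewrite -xu in uq.
by rewrite (bfs_mem (leq_addl d j) xj) in uq.
Qed.

Lemma bfs_target k : u k \in q k.+1.
Proof. by rewrite /= /bstep; case: ifP => //=; rewrite mem_rcons inE eqxx. Qed.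

Lemma bfs_memP k x : reflect (x = t0 \/ exists2 j, j < k & u j = x) (x \in q k).
Proof.
apply: (iffP idP) => [|[->|[j jk <-]]].
- elim: k => [|k IH] /=; first by rewrite inE => /eqP; left.
  rewrite /bstep; case: ifP => _ => [/IH|]; last first.
    rewrite /= mem_rcons inE => /orP[/eqP ->|/IH]; first by right; exists k.
    by case=> [|[j jk uj]]; [left|right; exists j => //; rewrite ltnS ltnW].
  by case=> [|[j jk uj]]; [left|right; exists j => //; rewrite ltnS ltnW].
- by apply: (bfs_mem (leq0n k)); rewrite inE.
- exact: bfs_mem jk (bfs_target j).
Qed.

Hypothesis conn : face_connected T.

Lemma bfs_size_le k : size (q k) <= n.
Proof. by rewrite -[n in X in _ <= X]card_ord -(card_uniqP (bfs_uniq k)) max_card. Qed.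

Lemma face_mul i (f : 'I_4) : face (4 * i + f) = f.
Proof. by apply: val_inj; rewrite /face val_insubd mulnC modnMDl modn_small ?ltn_ord. Qed.

Lemma div_mul i (f : 'I_4) : (4 * i + f) %/ 4 = i.
Proof. by rewrite mulnC divnMDl // divn_small ?addn0. Qed.

Lemma div_face k : 4 * (k %/ 4) + face k = k.
Proof. by rewrite val_insubd ltn_pmod //= mulnC -divn_eq. Qed.

(** If only [i.+1] tetrahedra were queued after [4 * i.+1] steps, all their faces would have been
    explored. The queue would then be closed under adjacency, hence contain all [n > i.+1]
    tetrahedra. *)
Lemma bfs_size_gt4 i : i < n -> i < size (q (4 * i)).
Proof.
elim/ltn_ind: i => -[|i] IH iN; first exact: bfs_size0.
rewrite ltnNge; apply/negP => sz.
have all_q t : t \in q (4 * i.+1).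
  have -> : (t \in q (4 * i.+1)) = (t \in [set x in q (4 * i.+1)]) by rewrite inE.
  move: t; apply: conn => [|t f]; first by exists t0; rewrite inE; apply/bfs_memP; left.
  rewrite !inE => tq; set j := index t (q (4 * i.+1)).
  have ji : j < i.+1 by apply: leq_trans sz; rewrite index_mem.
  have jn : j < n by apply: ltn_trans ji iN.
  have j4 f' : f' < 4 -> 4 * j + f' < 4 * i.+1 by lia.
  (* Face [f] of [t] bears the number [P (4 * j) t f], so this is the step at which it was
     explored. *)
  pose k := 4 * j + P (4 * j) t f.
  have kt : btet (bfs k) k = t.
    rewrite /btet div_mul (bfs_nth (leq_addr _ _)) ?IH //.
    have j4' : 4 * j <= 4 * i.+1 by rewrite leq_mul2l ltnW.
    by rewrite -(bfs_nth j4') ?IH // nth_index.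
  have tk : t \in q (4 * j).
    by rewrite -kt /btet div_mul (bfs_nth (leq_addr _ _)) ?mem_nth ?IH.
  apply: (bfs_mem (j4 _ (ltn_ord (P (4 * j) t f)))).
  rewrite -/k; suff -> : adj T t f = u k by exact: bfs_target.
  rewrite /btarget /bface kt face_mul (bfs_perm (leq_addr _ _) tk).
  by rewrite permK.
have : n <= size (q (4 * i.+1)).
  rewrite -[n in X in X <= _]card_ord -(card_uniqP (bfs_uniq (4 * i.+1))).
  by apply/subset_leq_card/fintype.subsetP => x _.
by move=> /leq_trans/(_ sz); rewrite leqNgt iN.
Qed.

Lemma bfs_size_gt k : k < 4 * n -> k %/ 4 < size (q k).
Proof.
move=> kn; have kn' : k %/ 4 < n by rewrite ltn_divLR // mulnC.
apply: leq_trans (bfs_size_gt4 kn') (bfs_size _).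
by rewrite mulnC leq_divM.
Qed.

Definition bfs_end := bfs (4 * n).
Local Notation Q := bfs_end.1.

Lemma size_bfs_end : size Q = n.
Proof.
have n0 : 0 < n by apply: leq_ltn_trans (ltn_ord t0).
apply/eqP; rewrite eqn_leq bfs_size_le /=.
rewrite -[n in X in X <= _](prednK n0); apply: leq_trans (bfs_size_gt4 _) (bfs_size _).
  by rewrite prednK.
by rewrite leq_mul2l leq_pred.
Qed.

Lemma mem_bfs_end x : x \in Q.
Proof.
rewrite (_ : (x \in Q) = (x \in 'I_n)) //.
apply: (@subset_cardP _ (mem Q) 'I_n _ _ x); last by apply/fintype.subsetP.
by rewrite card_ord (card_uniqP (bfs_uniq _)) size_bfs_end.
Qed.

Definition bfs_num (x : 'I_n) : 'I_n := insubd t0 (index x Q).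

Lemma val_bfs_num x : val (bfs_num x) = index x Q.
Proof. by rewrite val_insubd -[in X in _ < X]size_bfs_end index_mem mem_bfs_end. Qed.

Lemma bfs_num_inj : injective bfs_num.
Proof.
move=> x y /(congr1 val); rewrite !val_bfs_num => /(congr1 (nth t0 Q)).
by rewrite !nth_index ?mem_bfs_end.
Qed.

Definition bfs_lab : labelling n := (perm bfs_num_inj, bfs_end.2).

Lemma bfs_labE x : val (bfs_lab.1 x) = index x Q.
Proof. by rewrite permE val_bfs_num. Qed.

Lemma bfs_labV (i : 'I_n) : (bfs_lab.1^-1)%g i = nth t0 Q i.
Proof.
apply: (@perm_inj _ bfs_lab.1); apply: val_inj.
by rewrite permKV bfs_labE index_uniq ?size_bfs_end ?bfs_uniq.
Qed.

Lemma lt_cell (i : 'I_n) (f : 'I_4) : 4 * i + f < 4 * n.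
Proof. by case: i f => i /= ii [f /= ff]; lia. Qed.

(** Labels are never revised, so the tetrahedron examined at step [k] is already the one of cell [k]
    in the final relabelled table; the next lemmas say the same of faces and numberings. *)
Lemma btet_end (i : 'I_n) (f : 'I_4) (k := 4 * i + f) :
  btet (bfs k) k = (bfs_lab.1^-1)%g i.
Proof.
have kn := lt_cell i f.
rewrite bfs_labV /btet -/k (bfs_nth (ltnW kn)) //; first by rewrite div_mul.
by move: (bfs_size_gt kn); rewrite div_mul.
Qed.

Lemma btet_mem k : k < 4 * n -> btet (bfs k) k \in q k.
Proof. by move=> kn; rewrite mem_nth // bfs_size_gt. Qed.

Lemma bfs_perm_end k x : k <= 4 * n -> x \in q k -> P k x = bfs_lab.2 x.
Proof. by move=> kn xk; rewrite [RHS](bfs_perm kn xk). Qed.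

Lemma bface_end (i : 'I_n) (f : 'I_4) (k := 4 * i + f) :
  bface (bfs k) k = ((bfs_lab.2 ((bfs_lab.1^-1)%g i))^-1)%g f.
Proof.
have kn := lt_cell i f.
rewrite /bface btet_end bfs_perm_end ?(ltnW kn) //; first by rewrite face_mul.
by rewrite -(btet_end i f) btet_mem.
Qed.

Local Notation T' := (relabel T bfs_lab).

Lemma relabel_adj_bfs (i : 'I_n) (f : 'I_4) : adj T' i f = bfs_lab.1 (u (4 * i + f)).
Proof. by rewrite /adj ffunE /= /btarget btet_end bface_end. Qed.

Lemma relabel_gmap_bfs (i : 'I_n) (f : 'I_4) (k := 4 * i + f) (t := btet (bfs k) k) :
  gmap T' i f = ((bfs_lab.2 t)^-1 * gmap T t (bface (bfs k) k) * bfs_lab.2 (u k))%g.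
Proof. by rewrite /gmap ffunE /= /btarget /t btet_end bface_end. Qed.

Lemma nth_adj_bfs k : k < 4 * n -> nth t0 (adj_seq T') k = bfs_lab.1 (u k).
Proof.
move=> kn; have kn' : k %/ 4 < n by rewrite ltn_divLR // mulnC.
rewrite -[k in LHS]div_face -[k %/ 4]/(val (Ordinal kn')) nth_adj_seq relabel_adj_bfs.
by rewrite /= div_face.
Qed.

Lemma bfs_lab0 : val (bfs_lab.1 t0) = 0.
Proof. by rewrite bfs_labE -[X in index X](bfs_nth0 (4 * n)) index_uniq ?bfs_size0 ?bfs_uniq. Qed.

Lemma adj_bfs_before k i : k <= 4 * n -> 0 < bfs_lab.1 i -> i \in q k ->
  index (bfs_lab.1 i) (adj_seq T') < k.
Proof.
move=> kn i0 /bfs_memP[it|[j jk uj]]; first by rewrite it bfs_lab0 in i0.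
have jn : j < 4 * n by apply: leq_trans jk kn.
apply: leq_ltn_trans jk; apply: (@index_leq _ t0); first by rewrite size_adj_seq mulnC.
by rewrite nth_adj_bfs // uj.
Qed.

(** If [b] first appears at step [k], the queue then reaches position [b], so every smaller label is
    already in it and, if positive, has appeared before. A positive label first appearing at step
    [k] is not in the queue before that step, so [bstep] has just chosen its numbering. *)
Lemma canonical_bfs : Defs.canonical T'.
Proof.
apply/andP; split.
  apply/forallP => a; apply/forallP => b; apply/implyP => /andP[a0 ab].
  set k := index b (adj_seq T').
  have kn : k <= 4 * n by rewrite mulnC -(size_adj_seq T') index_size.
  rewrite -[a](permKV bfs_lab.1); apply: adj_bfs_before => //; first by rewrite permKV.
  (* The index is [4 * n] when [b] does not occur; by then everything has been queued. *)
  move: kn; rewrite leq_eqVlt => /orP[/eqP -> |kn]; first exact: mem_bfs_end.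
  have bk : bfs_lab.1 (u k) = b.
    by rewrite -nth_adj_bfs // nth_index // -index_mem size_adj_seq mulnC.
  have ib : index (u k) (q k.+1) = b.
    by rewrite -(bfs_index kn (bfs_target k)) -bk bfs_labE.
  have bsz : b < size (q k.+1) by rewrite -ib index_mem bfs_target.
  have am : nth t0 Q a \in q k.+1.
    by rewrite (bfs_nth kn) ?mem_nth // (ltn_trans ab).
  rewrite bfs_labV; case/bfs_memP: am => [->|[j jk uj]]; first by apply/bfs_memP; left.
  apply/bfs_memP; right; exists j => //; move: jk; rewrite ltnS leq_eqVlt => /orP[/eqP jk|//].
  have : index (u j) Q = a by rewrite uj index_uniq ?size_bfs_end ?bfs_uniq.
  by rewrite jk (bfs_index kn (bfs_target k)) ib => ba; rewrite ba ltnn in ab.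
apply/forallP => i; apply/forallP => f; apply/implyP => /andP[].
rewrite relabel_adj_bfs; set k := 4 * i + f => u0 /eqP uk.
have kn : k < 4 * n by exact: lt_cell.
have uq : u k \notin q k.
  by apply/negP => /(adj_bfs_before (ltnW kn) u0); rewrite uk ltnn.
apply/eqP; rewrite relabel_gmap_bfs -/k -(@bfs_perm_end k.+1 (u k)) ?bfs_target //.
rewrite [P k.+1 _](_ : _ = ((gmap T (btet (bfs k) k) (bface (bfs k) k))^-1
    * P k (btet (bfs k) k))%g); last first.
  by rewrite /= /bstep (negbTE uq) /= ffunE eqxx.
by rewrite (bfs_perm_end (ltnW kn)) ?btet_mem // mulgA mulgK mulVg.
Qed.

End Bfs.

(** * Every canonical labelling arises from a search *)

Section CanonicalIsBfs.
Variables (n : nat) (T : gluing n) (l : labelling n) (o : 'I_n).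
Hypothesis o0 : val o = 0.
Hypothesis canl : Defs.canonical (relabel T l).
Hypothesis conn : face_connected T.

Let t0 := (l.1^-1)%g o.
Let p := l.2 t0.
Local Notation s k := (bfs T t0 p k).

Let agrees k := (forall x, x \in (s k).1 -> val (l.1 x) = index x (s k).1)
  /\ (forall x, x \in (s k).1 -> (s k).2 x = l.2 x).

Lemma agrees_le j k : j <= k -> agrees k -> agrees j.
Proof.
move=> jk [h1 h2]; split=> x xj; have xk := bfs_mem jk xj.
  by rewrite h1 // (bfs_index jk).
by rewrite -h2 // (bfs_perm jk).
Qed.

Lemma agrees_cell k : k < 4 * n -> agrees k ->
  nth t0 (adj_seq (relabel T l)) k = l.1 (btarget T t0 (s k) k)
  /\ gmap (relabel T l) (l.1 (btet t0 (s k) k)) (face k)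
     = ((l.2 (btet t0 (s k) k))^-1 * gmap T (btet t0 (s k) k) (bface t0 (s k) k)
        * l.2 (btarget T t0 (s k) k))%g.
Proof.
move=> kn [h1 h2]; have tk := btet_mem t0 p conn kn.
have lt : val (l.1 (btet t0 (s k) k)) = k %/ 4.
  by rewrite h1 // index_uniq ?bfs_uniq ?bfs_size_gt.
have bf : bface t0 (s k) k = ((l.2 (btet t0 (s k) k))^-1)%g (face k).
  by rewrite /bface h2.
split; last by rewrite /gmap ffunE /= permK -bf.
by rewrite -[k in LHS]div_face -lt nth_adj_seq /adj ffunE /= permK -bf.
Qed.

(** As long as [l] agrees with the search, the entries of the relabelled table up to [k] are the
    labels of the tetrahedra met. Conditions (i) and (ii) then force the label and the numbering of
    a newly met one. *)
Lemma agrees_bfs k : k <= 4 * n -> agrees k.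
Proof.
elim: k => [|k IH] kn.
  split=> x; rewrite inE => /eqP ->; first by rewrite /= eqxx /t0 permKV.
  by rewrite ffunE.
have agk := IH (ltnW kn); have [h1 h2] := agk.
have [ek gk] := agrees_cell kn agk.
have earlier j : j < k -> nth t0 (adj_seq (relabel T l)) j = l.1 (btarget T t0 (s j) j)
    /\ btarget T t0 (s j) j \in (s k).1.
  move=> jk; split; last exact: bfs_mem jk (bfs_target _ _ _ _).
  by case: (agrees_cell (ltn_trans jk kn) (agrees_le (ltnW jk) agk)).
set u := btarget T t0 (s k) k in ek gk.
set t := btet t0 (s k) k in gk.
rewrite /agrees /= /bstep -/u; case: ifP => // uq /=.
(* Smaller labels are taken by queued tetrahedra. Were the label larger, the label [size (s k).1]
   would by (i) have appeared earlier, and its tetrahedron would be queued at a position outside the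
   queue. *)
have lu : val (l.1 u) = size (s k).1.
  apply/eqP; rewrite eqn_leq leqNgt; apply/andP; split; last first.
    rewrite leqNgt; apply/negP => lc.
    have := h1 _ (mem_nth t0 lc); rewrite index_uniq ?bfs_uniq // => /val_inj/perm_inj e.
    by move: uq; rewrite -e mem_nth.
  apply/negP => cl.
  have cn : size (s k).1 < n by apply: ltn_trans cl (ltn_ord _).
  case/andP: canl => /forallP/(_ (Ordinal cn))/forallP/(_ (l.1 u)) /implyP.
  rewrite /= bfs_size0 cl => /(_ isT) ilt _.
  have ik : index (l.1 u) (adj_seq (relabel T l)) <= k.
    by apply: (@index_leq _ t0); rewrite // size_adj_seq mulnC.
  have {ilt ik} ik := leq_trans ilt ik.
  have [ej uj] := earlier _ ik.
  move: ej; rewrite nth_index; last by rewrite -index_mem size_adj_seq mulnC (ltn_trans ik).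
  by move/(congr1 val); rewrite /= h1 // => e; move: uj; rewrite -index_mem -e ltnn.
(* Earlier targets are all queued and [u] is not, so its label first appears in cell [k], where (ii)
   applies. *)
have iu : index (l.1 u) (adj_seq (relabel T l)) = k.
  apply/eqP; rewrite eqn_leq (@index_leq _ t0) //=; last by rewrite size_adj_seq mulnC.
  rewrite leqNgt; apply/negP => ik.
  have [ej uj] := earlier _ ik.
  move: ej; rewrite nth_index; last by rewrite -index_mem size_adj_seq mulnC (ltn_trans ik).
  by move/perm_inj => e; move: uj; rewrite -e uq.
have tk : t \in (s k).1 by exact: (btet_mem t0 p conn kn).
have lt : val (l.1 t) = k %/ 4 by rewrite h1 // index_uniq ?bfs_uniq ?bfs_size_gt.
have lu2 : l.2 u = ((gmap T t (bface t0 (s k) k))^-1 * l.2 t)%g.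
  case/andP: canl => _ /forallP/(_ (l.1 t))/forallP/(_ (face k)) /implyP.
  have -> : adj (relabel T l) (l.1 t) (face k) = l.1 u.
    by rewrite -ek -[k in RHS]div_face -lt nth_adj_seq.
  rewrite iu lt div_face eqxx lu bfs_size0 => /(_ isT) /eqP.
  rewrite gk => /(congr1 (fun x => (gmap T t (bface t0 (s k) k))^-1 * l.2 t * x)%g).
  by rewrite mulg1 !mulgA mulgK mulVg mul1g => ->.
split=> x; rewrite mem_rcons inE => /orP[/eqP ->|xk].
- by rewrite lu -cats1 index_cat uq /= eqxx addn0.
- by rewrite h1 // -cats1 index_cat xk.
- by rewrite ffunE eqxx lu2 h2.
- rewrite ffunE; case: eqP => [xu|_]; last exact: h2.
  by rewrite -xu xk in uq.
Qed.

Lemma canonical_is_bfs : l = bfs_lab t0 p conn.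
Proof.
have [h1 h2] := agrees_bfs (leqnn _).
rewrite [LHS](surjective_pairing l) /bfs_lab; congr (_, _).
  by apply/permP => x; apply: val_inj; rewrite bfs_labE h1 ?mem_bfs_end.
by apply/ffunP => x; rewrite [RHS]h2 ?mem_bfs_end.
Qed.

End CanonicalIsBfs.

(** * Connectedness *)

Section Connectedness.
Local Open Scope classical_set_scope.
Local Open Scope quotient_scope.
Local Open Scope ring_scope.
Import GRing.Theory Num.Theory.

Lemma realization_connected (R : realType) n (T : gluing n) :
  paired T -> connected [set: realization R T] -> face_connected T.
Proof.
move=> pT cX C [c cC] Cadj t.
have glued_C (a b : tetrahedra R n) : glued T a b -> (projT1 a \in C) = (projT1 b \in C).
  case=> f [_ -> _]; apply/idP/idP => [|h]; first exact: Cadj.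
  (* Closure of [C] is given forwards only; the pairing of faces leads back across the gluing. *)
  suff -> : projT1 a = adj T (adj T (projT1 a) f) (gmap T (projT1 a) f f) by exact: Cadj.
  by have [_ e] := pT (projT1 a) f; rewrite [RHS]/adj e.
have ident_C (a b : tetrahedra R n) : identified T a b ->
    (projT1 a \in C) = (projT1 b \in C).
  by move=> /asboolP; elim=> [x y /glued_C||x y _ ->|x y z _ -> _ ->].
(* Membership is read off a representative, which is legitimate since identified points lie in
   tetrahedra on the same side of [C]. *)
pose D : set (realization R T) := [set x | projT1 (generic_quotient.repr x) \in C].
have piD (a : tetrahedra R n) : D (\pi_(realization R T) a) <-> projT1 a \in C.
  rewrite /D /=; suff -> : (projT1 (generic_quotient.repr (\pi_(realization R T) a)) \in C)
    = (projT1 a \in C) by [].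
  apply: ident_C; have /eqP := reprK (\pi_({eq_quot identified_equiv R T}) a).
  by rewrite eqmodE.
have open_tet (E : {set 'I_n}) : open [set a : tetrahedra R n | projT1 a \in E].
  apply/sigT_openP => i; case: (boolP (i \in E)) => iE.
    by rewrite (_ : _ @^-1` _ = setT); [exact: openT|apply/seteqP; split].
  rewrite (_ : _ @^-1` _ = set0); first exact: open0.
  by apply/seteqP; split => // x /=; rewrite (negbTE iE).
(* Each tetrahedron has a point, so [D] is nonempty, and [D = setT] puts every tetrahedron in
   [C]. *)
have vertex (u : 'I_n) : exists a : tetrahedra R n, projT1 a = u.
  have e0 : @tetrahedron R (delta_mx ord0 ord0).
    split=> [v|]; first by rewrite mxE ler0n.
    rewrite (bigD1 (ord0 : 'I_4)) //= [X in _ + X]big1 => [|v v0].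
      by rewrite mxE !eqxx addr0.
    by rewrite mxE eqxx (negbTE v0).
  by exists (existT _ u (SigSub (mem_set e0))).
have oD : open D.
  rewrite /open /= /quotient_open (_ : _ @^-1` _ = [set a | projT1 a \in C]); first exact: open_tet.
  by apply/seteqP; split=> a /piD.
have oDC : open (~` D).
  rewrite /open /= /quotient_open (_ : _ @^-1` _ = [set a : tetrahedra R n | projT1 a \in (~: C)%SET]); first exact: open_tet.
  by apply/seteqP; split=> a /=; rewrite inE => h; [apply/negP => /piD|move/piD; apply/negP].
have DT : D = setT.
  apply: cX.
  - by have [a ac] := vertex c; exists (\pi_(realization R T) a); apply/piD; rewrite ac.
  - by exists D => //; rewrite setTI.
  - by exists D; rewrite ?setTI // -[D]setCK; exact: open_closedC.
have [a at_] := vertex t.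
by rewrite -at_; apply/piD; rewrite DT.
Qed.

End Connectedness.

(** * Encodings *)

Section Lexi.
Context {d : Order.disp_t} {A : orderType d}.
Implicit Types s t a b : seqlexi A.

Lemma lexi_cat (a b s t : seq A) : size a = size b ->
  ((a ++ s : seqlexi A) <= (b ++ t : seqlexi A))%O
  = ((a : seqlexi A) < (b : seqlexi A))%O || (a == b) && ((s : seqlexi A) <= t)%O.
Proof.
elim: a b => [|x a IH] [|y b] //= [ab].
rewrite lexi_cons ltxi_cons IH // eqseq_cons.
by case: (ltgtP x y).
Qed.

Lemma lexi_cons_eq (x y : A) (s t : seq A) :
  ((x :: s : seqlexi A) <= (y :: t : seqlexi A))%O
  = (x < y)%O || (x == y) && ((s : seqlexi A) <= t)%O.
Proof. by rewrite lexi_cons; case: (ltgtP x y). Qed.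

End Lexi.

(** Peeling off the leading digit gives the recursion on which injectivity and the comparison of
    orders rest. *)
Lemma binaryS w k : k < 2 ^ w.+1 ->
  binary w.+1 k = (2 ^ w <= k) :: binary w (if 2 ^ w <= k then k - 2 ^ w else k).
Proof.
move=> kw; rewrite /binary /mkseq /= subn1 /=; congr (_ :: _).
  case: leqP => h; last by rewrite divn_small.
  by rewrite -(subnK h) divnDr // divnn expn_gt0 /= divn_small ?add0n //; rewrite expnS in kw; lia.
rewrite -[1]addn0 iotaDl -map_comp; apply/eq_in_map => i; rewrite mem_iota /= add0n => iw.
rewrite !add1n subSS; case: ifP => // h.
have -> : 2 ^ w = 2 ^ (w - i.+1) * 2 ^ i.+1 by rewrite -expnD subnK.
rewrite -[in LHS](subnK h) (_ : k - 2 ^ w + 2 ^ w = k - 2 ^ w + 2 ^ i.+1 * 2 ^ (w - i.+1)); last first.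
  by rewrite -expnD subnKC.
rewrite divnDMl ?expn_gt0 // oddD expnS oddM /= addbF.
by rewrite mulnC -expnS -expnD subnKC.
Qed.

Lemma size_binary w k : size (binary w k) = w.
Proof. exact: size_mkseq. Qed.

Lemma binary_inj w : {in [pred k | k < 2 ^ w] &, injective (binary w)}.
Proof.
elim: w => [|w IH] x y; rewrite !inE.
  by rewrite expn0 !ltnS !leqn0 => /eqP -> /eqP ->.
move=> xw yw; rewrite !binaryS // => -[xy]; rewrite -xy.
rewrite expnS in xw yw.
case: ifP => h; rewrite h in xy; have {}xy := esym xy.
  by move=> /IH; rewrite !inE => e; rewrite -(subnK h) e ?subnK //; lia.
by apply: IH; rewrite inE; lia.
Qed.

Lemma binary_lt w x y : x < 2 ^ w -> y < 2 ^ w ->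
  ((binary w x : seqlexi bool) < (binary w y : seqlexi bool))%O = (x < y).
Proof.
elim: w x y => [|w IH] x y.
  by rewrite expn0 !ltnS !leqn0 => /eqP -> /eqP ->; rewrite ltxx.
move=> xw yw; rewrite !binaryS // ltxi_cons; rewrite !expnS in xw yw.
case: (leqP (2 ^ w) x) => hx; case: (leqP (2 ^ w) y) => hy //=; rewrite ?IH //; try lia.
Qed.

Lemma lexi_binary w x y (s t : seq bool) : x < 2 ^ w -> y < 2 ^ w ->
  ((binary w x ++ s : seqlexi bool) <= (binary w y ++ t : seqlexi bool))%O
  = (x < y) || (x == y) && ((s : seqlexi bool) <= t)%O.
Proof.
move=> xw yw; rewrite lexi_cat ?size_binary // binary_lt //; congr (_ || _ && _).
by apply/eqP/eqP => [/binary_inj|->] //; apply.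
Qed.

(* A row of the table, for one face: a tetrahedron on [w] digits, then vertices. *)
Definition enc_row (w : nat) (r : seq nat) : seq bool :=
  binary w (head 0 r) ++ flatten [seq binary 2 v | v <- behead r].

Definition wf_row (w : nat) (r : seq nat) : bool :=
  [&& size r == 4, head 0 r < 2 ^ w & all (fun v => v < 4) (behead r)].

(** Corresponding entries occupy blocks of equal width, so the first differing bit lies in the first
    differing entry. *)
Lemma lexi_rows w (rs ss : seq (seq nat)) : size rs = size ss ->
  all (wf_row w) rs -> all (wf_row w) ss ->
  ((flatten [seq enc_row w r | r <- rs] : seqlexi bool)
     <= (flatten [seq enc_row w r | r <- ss] : seqlexi bool))%O
  = ((flatten rs : seqlexi nat) <= (flatten ss : seqlexi nat))%O.
Proof.
elim: rs ss => [|r rs IH] [|s ss] //= [sz] /andP[wr wrs] /andP[ws wss].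
case: r wr => [|r0 [|r1 [|r2 [|r3 []]]]] // /and3P[_ /= r0w /and4P[r1w r2w r3w _]].
case: s ws => [|s0 [|s1 [|s2 [|s3 []]]]] // /and3P[_ /= s0w /and4P[s1w s2w s3w _]].
have enc4 a b c d : enc_row w [:: a; b; c; d]
    = binary w a ++ (binary 2 b ++ (binary 2 c ++ binary 2 d)).
  by rewrite /enc_row -[X in _ = _ ++ (_ ++ (_ ++ X))]cats0.
by rewrite !enc4 -!catA !lexi_binary // !lexi_cons_eq IH.
Qed.

(** * The gluing table as a sequence of numbers, and the signature as a minimum *)

Section Table.
Variables (n : nat) (T : gluing n).

Definition rows : seq (seq nat) :=
  [seq val (adj T t f) :: face_images T t f | t <- enum 'I_n, f <- enum 'I_4].

Definition table : seq nat := flatten rows.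

Lemma input_tableE : input_table T = n :: table.
Proof. by []. Qed.

Lemma encodeE : encode T = flatten [seq enc_row (bitlen n.-1) r | r <- rows].
Proof. by rewrite /encode /rows map_allpairs. Qed.

Lemma size_rows : size rows = 4 * n.
Proof. by rewrite size_allpairs_ord mulnC. Qed.

Lemma face_imagesE t (f : 'I_4) : face_images T t f =
  [seq val (gmap T t f v) | v <- [:: inord 0; inord 1; inord 2; inord 3] & v != f].
Proof.
by rewrite /face_images; congr (map _ (seq.filter _ _)); apply: (inj_map val_inj);
   rewrite val_enum_ord /= !inordK.
Qed.

Lemma size_face_images t f : size (face_images T t f) = 3.
Proof. by rewrite size_map -rem_filter ?enum_uniq // size_rem ?mem_enum ?size_enum_ord. Qed.

Lemma wf_rows : all (wf_row (bitlen n.-1)) rows.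
Proof.
apply/allP => r /allpairsP[[t f] [_ _ ->]] /=.
rewrite /wf_row /= size_face_images /=; apply/andP; split.
  apply: leq_ltn_trans (ltn_bitlen n.-1).
  by case: n (adj T t f) => [[]|m i] //=; rewrite -ltnS.
by apply/allP => _ /mapP[v _ ->]; exact: ltn_ord.
Qed.

(* The image of vertex [v] is the entry number [slot f v] of the row of face [f]. *)
Definition slot (f v : nat) : nat := if v < f then v.+1 else v.
Definition unslot (f c : nat) : nat := if c <= f then c.-1 else c.

Lemma nth_row t (f v : 'I_4) : v != f ->
  nth 0 (val (adj T t f) :: face_images T t f) (slot f v) = gmap T t f v.
Proof.
rewrite face_imagesE.
case: f => -[|[|[|[|//]]]] hf; case: v => -[|[|[|[|//]]]] hv //= vf;
  rewrite -!val_eqE /= !inordK //=; congr (val (gmap T t _ _)); apply: val_inj; by rewrite //= inordK.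
Qed.

Lemma nth_table (t : 'I_n) (f : 'I_4) c : c < 4 ->
  nth 0 table (4 * (4 * t + f) + c) = nth 0 (val (adj T t f) :: face_images T t f) c.
Proof.
move=> c4; have tf := ltn_ord t; have ff := ltn_ord f.
rewrite nth_flatten_const //; last by rewrite size_rows; lia.
  by rewrite /rows nth_allpairs_ord.
by apply/allP => r /allpairsP[[t' f'] [_ _ ->]] /=; rewrite size_face_images.
Qed.

Lemma nth_table_adj (t : 'I_n) (f : 'I_4) : nth 0 table (4 * (4 * t + f)) = adj T t f.
Proof. by rewrite -[4 * (_ + _)]addn0 nth_table. Qed.


Lemma size_table : size table = 4 * (4 * n).
Proof.
rewrite (@size_flatten_const _ 4) ?size_rows //.
by apply/allP => r /allpairsP[[t' f'] [_ _ ->]] /=; rewrite size_face_images.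
Qed.

(** The 6 is three vertex images on two digits each. *)
Lemma size_encode : size (encode T) = 4 * n * (bitlen n.-1 + 6).
Proof.
rewrite encodeE (@size_flatten_const _ (bitlen n.-1 + 6)) ?size_map ?size_rows 1?mulnC //.
rewrite all_map; apply/allP => r /allpairsP[[t f] [_ _ ->]].
rewrite /preim inE /enc_row size_cat size_binary (@size_flatten_const _ 2).
  by rewrite size_map size_face_images.
by rewrite all_map; apply/allP => v _; rewrite /preim inE size_binary.
Qed.

End Table.

Lemma encode_le n (T1 T2 : gluing n) :
  ((encode T1 : seqlexi bool) <= (encode T2 : seqlexi bool))%O
  = ((table T1 : seqlexi nat) <= (table T2 : seqlexi nat))%O.
Proof. by rewrite !encodeE lexi_rows ?wf_rows // !size_rows. Qed.

Lemma isosig_min n (T : gluing n) (l : labelling n) :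
  Defs.canonical (relabel T l) ->
  (forall l', Defs.canonical (relabel T l') ->
     ((encode (relabel T l) : seqlexi bool) <= (encode (relabel T l') : seqlexi bool))%O) ->
  isosig T = encode (relabel T l).
Proof.
move=> cl lmin; rewrite /isosig; set s := map _ _.
have sl : encode (relabel T l) \in s.
  by apply/mapP; exists l => //; rewrite mem_filter cl mem_enum.
have : encode (relabel T l) \in sort (<=%O : rel (seqlexi bool)) s by rewrite mem_sort.
have : sorted (<=%O : rel (seqlexi bool)) (sort (<=%O : rel (seqlexi bool)) s).
  by apply: sort_sorted; exact: le_total.
have : forall x, x \in sort (<=%O : rel (seqlexi bool)) s ->
    ((encode (relabel T l) : seqlexi bool) <= (x : seqlexi bool))%O.
  move=> x; rewrite mem_sort => /mapP[l']; rewrite mem_filter => /andP[cl' _] ->.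
  exact: lmin.
case: (sort _ _) => //= x r xmin; rewrite le_path_sortedE => /andP[/allP xr _].
rewrite inE => /orP[/eqP //|/xr le1]; apply: (@le_anti _ (seqlexi bool)); apply/andP; split => //.
by apply: xmin; rewrite inE eqxx.
Qed.

(** An inequality, because [head] defaults to the empty sequence when no labelling is canonical. *)
Lemma size_isosig n (T : gluing n) : size (isosig T) <= 4 * n * (bitlen n.-1 + 6).
Proof.
rewrite /isosig; set s := map _ _.
have : forall x, x \in sort (<=%O : rel (seqlexi bool)) s -> size x = 4 * n * (bitlen n.-1 + 6).
  by move=> x; rewrite mem_sort => /mapP[l' _ ->]; rewrite size_encode.
by case: (sort _ _) => //= x r h; rewrite h // inE eqxx.
Qed.

(** * The program *)

Definition var (x : name) : aexp := Cell x (Lit 0).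
Definition setv (x : name) (e : aexp) : prog := PSet x (Lit 0) e.

(* Entry [c] of the input row of face [f] of tetrahedron [VI]; the input starts
   with [n]. *)
Definition inp_at (f c : nat) : aexp :=
  Inp (Plus (Quad (Plus (Quad (var VI)) (Lit f))) (Lit c.+1)).

(* The input omits the image of [f] itself, which is 6 minus the other three. *)
Definition image_at (f v : nat) : aexp :=
  if v == f then Minus (Lit 6) (Plus (inp_at f 1) (Plus (inp_at f 2) (inp_at f 3)))
  else inp_at f (slot f v).

Definition copy_face (f : nat) : prog :=
  fill Glue (fun v => Plus (Quad (Plus (Quad (var VI)) (Lit f))) (Lit v)) (image_at f) (iota 0 4).

Definition copy_input : prog := PFor VI VN (seqs [seq copy_face f | f <- iota 0 4]).

(** The last assignment turns the zero-initialised [Best] into the table [top]. *)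
Definition constants : prog := seqs
  [:: setv VN (Inp (Lit 0)); setv VN4 (Quad (var VN)); setv VN16 (Quad (var VN4));
      setv VTwo (Lit 2); PSet Best (Lit 0) (var VN)].

(* [VW] ends as the number of digits of [n - 1], far before the last iteration. *)
Definition powers : prog := seqs
  [:: PSet Pow (Lit 0) (Lit 1); PSet Pow (Lit 1) (Lit 2); setv VW (Lit 1);
      PFor VI VN (PIf (Minus (var VN) (Cell Pow (var VW)))
        (seqs [:: PSet Pow (Plus (var VW) (Lit 1))
                       (Plus (Cell Pow (var VW)) (Cell Pow (var VW)));
                  setv VW (Plus (var VW) (Lit 1))])
        PSkip)].

(** [Ipr] leads from the number [v] back to the vertex of the current tetrahedron, [Glue] across the
    current face. *)
Definition image_exp (v : nat) : aexp :=
  Cell Glue (Plus (Quad (var VX)) (Cell Ipr (Plus (Quad (var VT)) (Lit v)))).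

Definition load (f : nat) : prog := seqs
  [:: setv VT (Cell Tet (var VI));
      setv VF (Cell Ipr (Plus (Quad (var VT)) (Lit f)));
      setv VX (Plus (Quad (var VT)) (var VF));
      setv VU (Inp (Plus (Quad (var VX)) (Lit 1)))].

Definition enqueue : prog := seqs
  [:: PSet Lab (var VU) (Plus (var VCnt) (Lit 1));
      PSet Tet (var VCnt) (var VU);
      setv VCnt (Plus (var VCnt) (Lit 1))].

(** [image_exp] reads [Ipr], and [fill] must not read the array it writes; hence the detour through
    [Aux]. These images are the inverse numbering of the new tetrahedron, and [write_per] inverts it
    by writing [v] at the image of [v]. *)
Definition read_images : prog := fill Aux Lit image_exp (iota 0 4).

Definition write_ipr : prog :=
  fill Ipr (fun v => Plus (Quad (var VU)) (Lit v)) (fun v => Cell Aux (Lit v)) (iota 0 4).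

Definition write_per : prog :=
  fill Per (fun v => Plus (Quad (var VU)) (Cell Aux (Lit v))) Lit (iota 0 4).

Definition adopt : prog := seqs [:: enqueue; read_images; write_ipr; write_per].

Definition discover : prog := PIf (Cell Lab (var VU)) PSkip adopt.

Definition entry (f c : nat) : aexp :=
  if c == 0 then Minus (Cell Lab (var VU)) (Lit 1)
  else Cell Per (Plus (Quad (var VU)) (image_exp (unslot f c))).

Definition emit (f : nat) : prog :=
  fill Cur (fun c => Plus (Quad (Plus (Quad (var VI)) (Lit f))) (Lit c)) (entry f) (iota 0 4).

Definition step (f : nat) : prog := seqs [:: load f; discover; emit f].

Definition explore : prog := PFor VI VN (seqs [seq step f | f <- iota 0 4]).

(** What the previous candidate left in [Tet], [Per] and [Ipr] may stay: [bfs_inv] constrains them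
    on discovered tetrahedra only. *)
Definition clear : prog := PFor VI VN (PSet Lab (var VI) (Lit 0)).

Definition enter : prog := seqs
  [:: PSet Lab (var VStart) (Lit 1); PSet Tet (Lit 0) (var VStart); setv VCnt (Lit 1)].

Definition start_per (p : 'S_4) : prog :=
  fill Per (fun v => Plus (Quad (var VStart)) (Lit v)) (fun v => Lit (p (inord v))) (iota 0 4).

Definition start_ipr (p : 'S_4) : prog :=
  fill Ipr (fun v => Plus (Quad (var VStart)) (Lit v))
           (fun v => Lit ((p^-1)%g (inord v))) (iota 0 4).

Definition start (p : 'S_4) : prog := seqs [:: clear; enter; start_per p; start_ipr p].

(* The scan goes from the last entry to the first, so that each difference
   overrides the verdict on the entries that follow it. *)
Definition compare : prog := seqs
  [:: setv VCmp (Lit 0);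
      PFor VI VN16 (seqs
        [:: setv VX (Minus (var VN16) (Plus (var VI) (Lit 1)));
            PIf (Minus (Cell Best (var VX)) (Cell Cur (var VX))) (setv VCmp (Lit 1))
              (PIf (Minus (Cell Cur (var VX)) (Cell Best (var VX))) (setv VCmp (Lit 0)) PSkip)])].

Definition keep_min : prog :=
  PIf (var VCmp) (PFor VI VN16 (PSet Best (var VI) (Cell Cur (var VI)))) PSkip.

Definition candidate (p : 'S_4) : prog := seqs [:: start p; explore; compare; keep_min].

(* The 24 numberings of the vertices are unrolled in the program text. *)
Definition search : prog :=
  PFor VStart VN (seqs [seq candidate p | p <- enum 'S_4]).

(** With truncated subtraction, [1 - (2 ^ j - x)] is 1 if [2 ^ j <= x] and 0 otherwise. A loop bound
    must be a name, which is why the width 2 is kept in [VTwo]. *)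
Definition print_bin (w : name) : prog :=
  PFor VJ w (seqs
    [:: setv VY (Cell Pow (Minus (var w) (Plus (var VJ) (Lit 1))));
        setv VF (Minus (Lit 1) (Minus (var VY) (var VX)));
        POut (var VF);
        PIf (var VF) (setv VX (Minus (var VX) (var VY))) PSkip]).

Definition print_entry (c : nat) : prog :=
  PSeq (setv VX (Cell Best (Plus (Quad (var VI)) (Lit c)))) (print_bin (if c == 0 then VW else VTwo)).

Definition print_best : prog := PFor VI VN4 (seqs [seq print_entry c | c <- iota 0 4]).

Definition main : prog :=
  seqs [:: constants; powers; copy_input; search; print_best].

(** The list [enum 'S_4] is never evaluated: syntactic facts about [search] are settled for a
    generic [p]. *)
Lemma writes_search a : writes search a -> exists p, writes (candidate p) a || same a VStart.
Proof.
rewrite [writes _ _]/= writes_seqs => /orP[->|]; first by exists 1%g; rewrite orbT.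
by rewrite has_map => /hasP[p _ h]; exists p; apply/orP; left.
Qed.

Lemma wf_search : wf search.
Proof.
rewrite /search [wf _]/= !writes_seqs wf_seqs !has_map all_map -!all_predC.
by apply/and3P; split; apply/allP.
Qed.

Lemma wf_main : wf main.
Proof. by rewrite /main; move: search wf_search => c h; rewrite wf_seqs /= h. Qed.

Lemma depth_main : depth main <= 2.
Proof.
have : depth search <= 2 by rewrite ltnS depth_seqs all_map; apply/allP.
by rewrite /main; move: search => c h; rewrite depth_seqs /= h.
Qed.

Arguments fill : simpl never.
Arguments load : simpl never.
Arguments discover : simpl never.
Arguments emit : simpl never.
Arguments step : simpl never.

Definition tape n (T : gluing n) : nat -> nat := nth 0 (input_table T).

(** [VN16] attains [16 * n]; the summand 16 makes room for the small literals and keeps the bound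
    positive. *)
Definition bound (n : nat) : nat := 16 * n + 16.

(** * Correctness of the precomputation *)

Section Correct.
Variables (n : nat) (T : gluing n).

Local Notation inp := (tape T).
Local Notation B := (bound n).

Lemma inp_bound i : inp i <= B.
Proof.
rewrite /tape input_tableE; case: i => [|i] /=; first by rewrite /bound; lia.
have [szi|szi] := ltnP i (size (table T)); last by rewrite nth_default.
suff /allP -> : all (fun x => x <= B) (table T) by [|exact: mem_nth].
apply/allP => x /flattenP[r /allpairsP[[t f] [_ _ ->]]]; rewrite inE => /orP[/eqP ->|].
  by have := ltn_ord (adj T t f); rewrite /bound /=; lia.
by move=> /mapP[v _ ->]; have := ltn_ord (gmap T t f v); rewrite /bound /=; lia.
Qed.

Definition glue_ok (k : nat) (s : store) : Prop :=
  forall (t : 'I_n) (f v : 'I_4), t < k -> s Glue (4 * (4 * t + f) + v) = gmap T t f v.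

Definition pow_ok (s : store) : Prop := forall i, i <= s VW 0 -> s Pow i = 2 ^ i.

Definition context (s : store) : Prop :=
  [/\ s VN 0 = n, s VN4 0 = 4 * n, s VN16 0 = 4 * (4 * n), s VTwo 0 = 2
    & [/\ s VW 0 = bitlen n.-1, pow_ok s & glue_ok n s]].

(** The names are ordered so that the seven on which [context] depends come first. *)
Lemma context_frame s s' : (forall a, code a < 7 -> s' a = s a) -> context s -> context s'.
Proof.
move=> h [h1 h2 h3 h4 [h5 h6 h7]].
by rewrite /context /pow_ok /glue_ok !h.
Qed.

Lemma sum_images t (f : 'I_4) :
  6 - (nth 0 (val (adj T t f) :: face_images T t f) 1
     + (nth 0 (val (adj T t f) :: face_images T t f) 2
      + nth 0 (val (adj T t f) :: face_images T t f) 3)) = gmap T t f f.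
Proof.
have : sumn (face_images T t f) + gmap T t f f = 6.
  rewrite sumnE big_map big_filter big_enum_cond addnC.
  rewrite -(bigD1 (P := predT) f) //= (reindex_inj (@perm_inj _ (gmap T t f)^-1%g)) /=.
  under eq_bigr do rewrite permKV.
  by rewrite !big_ord_recl big_ord0.
by have := size_face_images T t f; case: (face_images T t f) => [|a [|b [|c []]]] //= _; lia.
Qed.

Lemma aeval_inp_at (s : store) (t : 'I_n) (f : 'I_4) c : s VI 0 = t -> c < 4 ->
  aeval inp s (inp_at f c) = nth 0 (val (adj T t f) :: face_images T t f) c.
Proof.
by move=> st c4; rewrite /= st /tape input_tableE addnS [nth _ (_ :: _) _.+1]/= nth_table.
Qed.

Lemma aeval_image_at (s : store) (t : 'I_n) (f v : 'I_4) : s VI 0 = t ->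
  aeval inp s (image_at f v) = gmap T t f v.
Proof.
move=> st; rewrite /image_at; case: eqP => [e|/eqP vf].
  rewrite (val_inj e) -sum_images -!(aeval_inp_at f st) //.
rewrite (aeval_inp_at f st) ?nth_row //.
rewrite /slot; have ff := ltn_ord f.
by case: (ltnP v f) => h //; apply: leq_ltn_trans ff.
Qed.

Lemma seqs4_spec (c : nat -> prog) (J : nat -> state -> Prop) :
  (forall (f : 'I_4) s, J f s -> safe inp B (c f) s /\ J f.+1 (den inp (c f) s)) ->
  forall s, J 0 s -> safe inp B (seqs [seq c f | f <- iota 0 4]) s
    /\ J 4 (den inp (seqs [seq c f | f <- iota 0 4]) s).
Proof.
move=> h s0 J0.
have [f0 J1] := h (@Ordinal 4 0 isT) _ J0.
have [f1 J2] := h (@Ordinal 4 1 isT) _ J1.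
have [f2 J3] := h (@Ordinal 4 2 isT) _ J2.
have [f3 J4] := h (@Ordinal 4 3 isT) _ J3.
by [].
Qed.

Lemma copy_face_spec (t : 'I_n) (f : 'I_4) (s : state) : s.1 VI 0 = t ->
  [/\ safe inp B (copy_face f) s,
      forall v : 'I_4, (den inp (copy_face f) s).1 Glue (4 * (4 * t + f) + v) = gmap T t f v
    & forall j, j < 4 * (4 * t + f) ->
        (den inp (copy_face f) s).1 Glue j = s.1 Glue j].
Proof.
move=> st.
have [|||sf h1 h2] := @fill_spec inp B Glue
  (fun v => Plus (Quad (Plus (Quad (var VI)) (Lit f))) (Lit v)) (image_at f) (iota 0 4) s.
- by move=> c; rewrite /image_at; case: eqP.
- move=> c; rewrite mem_iota => /andP[_ c4]; rewrite (aeval_image_at f (Ordinal c4) st).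
  by have := ltn_ord (gmap T t f (Ordinal c4)); rewrite /bound; lia.
- by move=> c c' _ _ /= /addnI ->.
split=> // [v|j jl].
  have := h1 v; rewrite mem_iota ltn_ord => /(_ isT).
  by rewrite (aeval_image_at f v st) /= st.
by apply: h2 => c _ /=; rewrite st; lia.
Qed.

Lemma copy_input_spec (s : state) : s.1 VN 0 = n ->
  safe inp B copy_input s /\ glue_ok n (den inp copy_input s).1.
Proof.
move=> sn.
have [//|//|k t|sf] := @for_spec inp B VI VN (seqs [seq copy_face f | f <- iota 0 4]) s
  (fun k s => glue_ok k s.1); last by rewrite sn.
rewrite sn => kn tk _ gk.
pose J m (s : state) := s.1 VI 0 = k /\ forall (t : 'I_n) (f v : 'I_4),
  4 * t + f < 4 * k + m -> s.1 Glue (4 * (4 * t + f) + v) = gmap T t f v.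
have [f u [uk gu]||sf [_ gl]] := @seqs4_spec copy_face J _ t.
- have [s1 s2 s3] := @copy_face_spec (Ordinal kn) f u uk.
  split=> //; split; first by rewrite den_frame.
  move=> t' f' v; rewrite addnS ltnS leq_eqVlt => /orP[/eqP e|lt'].
    have et : t' = Ordinal kn by apply: val_inj => /=; have := ltn_ord f; have := ltn_ord f'; lia.
    have ef : f' = f by apply: val_inj; move: e; rewrite et /= => /addnI.
    by rewrite et ef s2.
  by rewrite s3 ?gu //=; have := ltn_ord v; lia.
- by split=> // t' f' v; rewrite addn0 => h; apply: gk; lia.
split; first exact: sf.
move: {sf} (den inp _ t) gl => r gl t' f v h.
by rewrite /= put_neq //; apply: gl; have := ltn_ord f; lia.
Qed.

Lemma powers_spec (s : state) : 0 < n -> s.1 VN 0 = n ->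
  [/\ safe inp B powers s, pow_ok (den inp powers s).1
    & (den inp powers s).1 VW 0 = bitlen n.-1].
Proof.
move=> n0 sn; rewrite /powers.
set body := PIf _ _ _; set loop := PFor VI VN body.
set s1 : state := (put (put (put s.1 Pow 0 1) Pow 1 2) VW 0 1, s.2).
(* Either [2 ^ w] has reached [n], or [w] has grown in every iteration, and then it ends as [n.+1],
   which is large enough. The [maxn 2] admits [n = 1], where [bitlen 0 = 1]. *)
have [|k t|sf] := @for_spec inp B VI VN body s1 (fun k t =>
  [/\ 0 < t.1 VW 0, pow_ok t.1, 2 ^ (t.1 VW 0).-1 < maxn 2 n
    & n <= 2 ^ t.1 VW 0 \/ t.1 VW 0 = k.+1]) isT.
- split=> //=; [by move=> [|[|i]]|by rewrite leq_max|by right].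
- rewrite (_ : s1.1 VN 0 = n) // => kn tk fr [w0 pw wn wk].
  have tn : t.1 VN 0 = n by rewrite fr.
  rewrite /body /= tn pw //; case: ifP => [lt|/negbFE ge]; last first.
    by split=> //; split=> //=; left; rewrite -subn_eq0.
  have {}lt : 2 ^ t.1 VW 0 < n by rewrite -subn_gt0 lt0n.
  have wB : 2 ^ t.1 VW 0 + 2 ^ t.1 VW 0 <= B by rewrite /bound; lia.
  rewrite /put /same /=.
  have WB : t.1 VW 0 + 1 <= B by have := ltn_expl (t.1 VW 0) (isT : 1 < 2); rewrite /bound; lia.
  split; first by [].
  rewrite addn1; split=> //=.
  + rewrite /pow_ok /= => i; case: eqP => [-> _|ne le]; first by rewrite expnS mul2n addnn.
    by apply: pw; lia.
  + by rewrite leq_max lt orbT.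
  + by right; case: wk => [h|-> //]; move: lt; rewrite ltnNge h.
rewrite (_ : s1.1 VN 0 = n) // => -[w0 pw wn wk].
have -> : den inp (seqs [:: PSet Pow (Lit 0) (Lit 1); PSet Pow (Lit 1) (Lit 2);
   setv VW (Lit 1); loop]) s = den inp loop s1 by [].
set r := den inp loop s1 in pw w0 wn wk *.
split=> //.
  by split; [rewrite /= /bound; lia|split; [rewrite /= /bound; lia|split; [rewrite /= /bound; lia|]]].
have nw : n <= 2 ^ r.1 VW 0.
  by case: wk => // ->; have := ltn_expl n.+1 (isT : 1 < 2); lia.
case: (ltnP 1 n) => n1; last first.
  have -> : n = 1 by lia.
  move: wn; rewrite (maxn_idPl (leqW n1)); case: (r.1 VW 0) w0 => [//|[//|w]] _ /=.
  by rewrite expnS; have := expn_gt0 2 w; lia.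
rewrite /bitlen -[LHS](prednK w0); congr _.+1; symmetry; apply: trunc_log_eq => //.
rewrite (maxn_idPr n1) in wn.
by rewrite (prednK w0) -ltnS (prednK n0) wn.
Qed.

End Correct.

(** * Exploring one face *)

Section Explore.
Variables (n : nat) (T : gluing n) (t0 : 'I_n) (p : 'S_4).
Hypothesis conn : face_connected T.

Local Notation inp := (tape T).
Local Notation B := (bound n).
Local Notation st k := (bfs T t0 p k).
Local Notation u k := (btarget T t0 (st k) k).
Local Notation t k := (btet t0 (st k) k).
Local Notation x k := (bface t0 (st k) k).

(** The store mirrors the search state after [k] steps. [Lab] must be right everywhere, since its
    zeros are what detects a new tetrahedron. *)
Definition bfs_inv (k : nat) (s : store) : Prop :=
  [/\ s VCnt 0 = size (st k).1,
      forall j, j < size (st k).1 -> s Tet j = nth t0 (st k).1 j,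
      forall y : 'I_n, s Lab y = if y \in (st k).1 then (index y (st k).1).+1 else 0
    & forall (y : 'I_n) (v : 'I_4), y \in (st k).1 ->
        s Per (4 * y + v) = (st k).2 y v /\ s Ipr (4 * y + v) = ((st k).2 y)^-1%g v].

Lemma bfs_inv_frame k s s' :
  (forall a, code a \in [:: 16; 18; 19; 20; 21] -> s' a = s a) -> bfs_inv k s -> bfs_inv k s'.
Proof.
move=> h [h1 h2 h3 h4]; split=> [|j jk|y|y v yk]; rewrite !h //.
  exact: h2.
exact: h4.
Qed.

Definition new_table : seq nat := table (relabel T (bfs_lab t0 p conn)).

Definition cur_inv (k : nat) (s : store) : Prop :=
  forall j, j < 4 * k -> s Cur j = nth 0 new_table j.

Definition loaded (k : nat) (s : store) : Prop :=
  [/\ s VT 0 = t k, s VX 0 = 4 * t k + x k & s VU 0 = u k].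

Lemma load_spec (i : 'I_n) (f : 'I_4) (s : state) (k := 4 * i + f) :
  s.1 VI 0 = i -> bfs_inv k s.1 ->
  safe inp B (load f) s /\ loaded k (den inp (load f) s).1.
Proof.
move=> si [_ hT _ hP].
have kn : k < 4 * n by exact: lt_cell.
have isz : i < size (st k).1 by have := bfs_size_gt t0 p conn kn; rewrite div_mul.
have tE : s.1 Tet i = t k by rewrite hT // /btet div_mul.
have tk : t k \in (st k).1 by exact: (btet_mem t0 p conn kn).
have xE : s.1 Ipr (4 * t k + f) = x k.
  by have [_ ->] := hP (t k) f tk; rewrite /bface face_mul.
have uE : inp (4 * (4 * t k + x k) + 1) = u k.
  by rewrite /tape input_tableE addn1 [LHS]/= nth_table_adj.
have tB := ltn_ord (t k); have xB := ltn_ord (x k); have uB := ltn_ord (u k).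
rewrite /load /loaded /= /put /same /= !si !tE !xE !uE /bound.
by split=> //; do !split; lia.
Qed.

Lemma imageE s k : loaded k s -> bfs_inv k s -> glue_ok T n s -> t k \in (st k).1 ->
  forall v : 'I_4, aeval inp s (image_exp v) = gmap T (t k) (x k) (((st k).2 (t k))^-1%g v).
Proof.
move=> [sT sX _] [_ _ _ hP] gk tk v.
rewrite /image_exp /= sT sX; have [_ ->] := hP (t k) v tk.
by rewrite gk.
Qed.

Lemma image_lt4 s k : loaded k s -> bfs_inv k s -> glue_ok T n s -> t k \in (st k).1 ->
  forall c, c \in iota 0 4 -> aeval inp s (image_exp c) < 4.
Proof.
move=> ls is_ gk tk c; rewrite mem_iota => /andP[_ c4].
by rewrite (imageE ls is_ gk tk (Ordinal c4)) ltn_ord.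
Qed.

Lemma discover_spec (s : state) k : k < 4 * n ->
  loaded k s.1 -> bfs_inv k s.1 -> glue_ok T n s.1 ->
  safe inp B discover s /\ bfs_inv k.+1 (den inp discover s).1.
Proof.
move=> kn ls is_ gk.
have tk : t k \in (st k).1 by exact: (btet_mem t0 p conn kn).
have [sT sX sU] := ls; have [hC hT hL hP] := is_.
have szn := bfs_size_le T t0 p k.
have hU : (aeval inp s.1 (Cell Lab (var VU)) != 0) = (u k \in (st k).1).
  by rewrite /= sU hL; case: ifP.
rewrite /discover safe_if den_if hU.
case: (boolP (u k \in (st k).1)) => uk; cbv iota.
  by rewrite /bfs_inv /= /bstep uk.
set s1 := den inp enqueue s.
set s2 := den inp read_images s1.
set s3 := den inp write_ipr s2.
set s4 := den inp write_per s3.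
have s1V : s1 = (put (put (put s.1 Lab (u k) (size (st k).1).+1) Tet (size (st k).1) (u k))
    VCnt 0 (size (st k).1).+1, s.2).
  by rewrite /s1 /= /put /same /= hC sU addn1.
rewrite /adopt den_seqs4 -/s1 -/s2 -/s3 -/s4.
have sf1 : safe inp B enqueue s.
  have := ltn_ord (u k).
  by rewrite /= /put /same /= hC sU /bound; do !split => //; lia.
suff [sf2 sf3 sf4 fin] : [/\ safe inp B read_images s1, safe inp B write_ipr s2,
    safe inp B write_per s3 & bfs_inv k.+1 s4.1].
  by split; [exact: safe_seqs4 sf1 sf2 sf3 sf4|exact: fin].
have is1 : forall c, aeval inp s1.1 (image_exp c) = aeval inp s.1 (image_exp c) by [].
have g4 := image_lt4 ls is_ gk tk.
(* The inverse of the numbering that [bstep] gives to [u k]. *)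
pose g (v : 'I_4) := gmap T (t k) (x k) (((st k).2 (t k))^-1%g v).
have gE (v : 'I_4) : aeval inp s1.1 (image_exp v) = g v by rewrite is1 (imageE ls is_ gk tk).
have [//|c c4|c c' _ _|sf2 in2 out2] := @fill_spec inp B Aux Lit image_exp (iota 0 4) s1.
- by rewrite is1 (leq_trans (ltnW (g4 c c4))) // /bound; lia.
- by move=> /= ->.
have A2 (v : 'I_4) : s2.1 Aux v = g v.
  by rewrite -gE -(in2 v) // mem_iota ltn_ord.
have F2 a : ~~ same a Aux -> s2.1 a = s1.1 a.
  by move=> h; rewrite /s2 den_frame //; case: a h.
have U2 : s2.1 VU 0 = u k by rewrite F2 // s1V.
clear in2 out2; clearbody s2.
have [//|c|c c' _ _|sf3 in3 out3] := @fill_spec inp B Ipr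
  (fun v => Plus (Quad (var VU)) (Lit v)) (fun v => Cell Aux (Lit v)) (iota 0 4) s2.
- rewrite mem_iota => /andP[_ c4]; rewrite /= (A2 (Ordinal c4)).
  by have := ltn_ord (g (Ordinal c4)); rewrite /bound; lia.
- by rewrite /= => /addnI ->.
have I3 (v : 'I_4) : s3.1 Ipr (4 * u k + v) = g v.
  by have := in3 v; rewrite mem_iota ltn_ord /= U2 A2 => ->.
have I3' j : (j < 4 * u k) || (4 * u k + 4 <= j) -> s3.1 Ipr j = s.1 Ipr j.
  move=> hj; rewrite /s3 out3; last first.
    by move=> c; rewrite mem_iota /= U2 add0n; lia.
  by rewrite F2 // s1V.
have F3 a : ~~ same a Ipr -> s3.1 a = s2.1 a.
  by move=> h; rewrite /s3 den_frame //; case: a h.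
have U3 : s3.1 VU 0 = u k by rewrite F3.
have A3 (v : 'I_4) : s3.1 Aux v = g v by rewrite F3 // A2.
clear in3 out3; clearbody s3.
(* Distinct [v] are thus written to distinct entries of [Per], as [fill_spec] requires. *)
have gI : injective g by move=> v w /perm_inj/perm_inj.
have [//|c|c c'|sf4 in4 out4] := @fill_spec inp B Per
  (fun v => Plus (Quad (var VU)) (Cell Aux (Lit v))) Lit (iota 0 4) s3.
- by rewrite mem_iota /= => c4; rewrite /bound; lia.
- rewrite !mem_iota /= !add0n => c4 c4'.
  by rewrite (A3 (Ordinal c4)) (A3 (Ordinal c4')) => /addnI/ord_inj/gI [].
have P4 (v : 'I_4) : s4.1 Per (4 * u k + g v) = v.
  by have := in4 v; rewrite mem_iota ltn_ord /= U3 A3 => ->.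
have P4' j : (j < 4 * u k) || (4 * u k + 4 <= j) -> s4.1 Per j = s.1 Per j.
  move=> hj; rewrite /s4 out4; last first.
    move=> c; rewrite mem_iota /= U3 add0n => c4; rewrite (A3 (Ordinal c4)).
    by have := ltn_ord (g (Ordinal c4)); lia.
  by rewrite F3 // F2 // s1V.
have F4 a : ~~ same a Per -> s4.1 a = s3.1 a.
  by move=> h; rewrite /s4 den_frame //; case: a h.
clear in4 out4; clearbody s4.
have fr a : code a \in [:: 16; 18; 19] -> s4.1 a = s1.1 a.
  by case: a => // _; rewrite F4 // F3 // F2.
clearbody s1.
split=> //; rewrite /bfs_inv [st k.+1]/= /bstep (negbTE uk) /=; split.
- by rewrite fr // s1V size_rcons.
- move=> j; rewrite size_rcons ltnS fr // s1V /put /same /= nth_rcons.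
  case: ltngtP => //= jk _.
  by rewrite hT.
- move=> y; rewrite fr // s1V /put /same /= mem_rcons inE -cats1 index_cat.
  rewrite -val_eqE; case: eqP => [/val_inj -> |ne] /=; first by rewrite (negbTE uk) /= eqxx addn0.
  by rewrite hL; case: ifP.
- move=> y v; rewrite mem_rcons inE ffunE; case: eqP => [->|ne] /= yk.
    split.
      rewrite -[v in LHS](permKV (gmap T (t k) (x k))).
      rewrite -[((gmap T (t k) (x k))^-1)%g v](permK ((st k).2 (t k))) -/(g _) P4.
      by rewrite permM.
    by rewrite F4 // I3 /g invMg invgK permM.
  have vv := ltn_ord v; have ne' : val y <> val (u k) by move=> /val_inj.
  (* The blocks of four entries of distinct tetrahedra are disjoint. *)
  have off : (4 * y + v < 4 * u k) || (4 * u k + 4 <= 4 * y + v) by move: ne' => /=; lia.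
  by rewrite P4' // F4 // I3' //; exact: hP.
Qed.

Lemma unslotK f c : 0 < c -> slot f (unslot f c) = c.
Proof.
rewrite /slot /unslot; case: c => // c _.
by case: (leqP c.+1 f) => h; [rewrite /= h|rewrite ltnNge (ltnW h)].
Qed.

Lemma unslot_neq f c : 0 < c -> unslot f c != f.
Proof. by rewrite /unslot; case: (leqP c f) => h c0; lia. Qed.

Lemma unslot_lt f c : f < 4 -> c < 4 -> unslot f c < 4.
Proof. by rewrite /unslot; case: (leqP c f) => h; lia. Qed.

(** After step [k] both sides of the face are queued, so their labels and numberings are final and
    the row can be written at once. *)
Lemma emit_spec (i : 'I_n) (f : 'I_4) (s : state) (k := 4 * i + f) :
  s.1 VI 0 = i -> loaded k s.1 -> bfs_inv k.+1 s.1 -> glue_ok T n s.1 -> cur_inv k s.1 ->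
  safe inp B (emit f) s /\ cur_inv k.+1 (den inp (emit f) s).1.
Proof.
move=> si [sT sX sU] [_ _ hL hP] gk cur.
have kn : k < 4 * n by exact: lt_cell.
have tk : t k \in (st k).1 by exact: (btet_mem t0 p conn kn).
have tk1 : t k \in (st k.+1).1 by exact: bfs_mem (leqnSn k) tk.
have uk1 := bfs_target T t0 p k.
have eE c : c < 4 -> aeval inp s.1 (entry f c) = nth 0 new_table (4 * k + c).
  move=> c4; rewrite /new_table nth_table // /entry; case: eqP => [->|/eqP].
    rewrite relabel_adj_bfs /= sU hL uk1 subn1 /=.
    by rewrite [RHS]bfs_labE; symmetry; exact: bfs_index kn uk1.
  rewrite -lt0n => c0; rewrite -[c in RHS](unslotK f c0).
  pose v := Ordinal (unslot_lt (ltn_ord f) c4).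
  have := @nth_row _ (relabel T (bfs_lab t0 p conn)) i f v; rewrite /= => ->; last first.
    by rewrite -val_eqE /= unslot_neq.
  rewrite relabel_gmap_bfs -/k -(bfs_perm_end conn kn uk1) -(bfs_perm_end conn kn tk1).
  rewrite !permM /= sU sX sT.
  have [_ ->] := hP (t k) v tk1; rewrite gk ?ltn_ord //.
  by have [-> _] := hP (u k) (gmap T (t k) (x k) (((st k.+1).2 (t k))^-1%g v)) uk1.
have rd c : ~~ reads (Plus (Quad (Plus (Quad (var VI)) (Lit f))) (Lit c)) Cur
    && ~~ reads (entry f c) Cur by rewrite /entry; case: eqP.
have [c|c c' _ _|sf h1 h2] := @fill_spec inp B Cur
  (fun c => Plus (Quad (Plus (Quad (var VI)) (Lit f))) (Lit c)) (entry f) (iota 0 4) s rd.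
- rewrite mem_iota add0n /= => c4; rewrite eE //.
  have lt j : nth 0 new_table j <= B.
    have := @inp_bound n (relabel T (bfs_lab t0 p conn)) j.+1.
    by rewrite /tape input_tableE.
  exact: lt.
- by rewrite /= => /addnI ->.
split=> // j; rewrite mulnS addnC => jk.
case: (ltnP j (4 * k)) => jk'.
  by rewrite h2 ?cur // => c _; rewrite /= si -/k; lia.
have c4 : j - 4 * k < 4 by lia.
rewrite -(subnKC jk') -eE // -h1; last by rewrite mem_iota.
by rewrite /= si.
Qed.

Lemma step_spec (i : 'I_n) (f : 'I_4) (s : state) (k := 4 * i + f) :
  s.1 VI 0 = i -> bfs_inv k s.1 -> glue_ok T n s.1 -> cur_inv k s.1 ->
  safe inp B (step f) s /\
  [/\ bfs_inv k.+1 (den inp (step f) s).1 & cur_inv k.+1 (den inp (step f) s).1].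
Proof.
move=> si is_ gk cur.
have [sf1 ld1] := load_spec si is_.
set s1 := den inp (load f) s in ld1.
have i1 : bfs_inv k s1.1.
  by apply: bfs_inv_frame is_ => a ca; rewrite /s1 den_frame //; case: a ca.
have g1 : glue_ok T n s1.1 by move=> y z v yn; rewrite /s1 den_frame // gk.
have [sf2 i2] := discover_spec (lt_cell i f) ld1 i1 g1.
set s2 := den inp discover s1 in i2.
have [ld11 ld12 ld13] := ld1.
have ld2 : loaded k s2.1 by split; rewrite /s2 den_frame.
have g2 : glue_ok T n s2.1 by move=> y z v yn; rewrite /s2 den_frame // g1.
have c2 : cur_inv k s2.1.
  by move=> j jk; rewrite /s2 den_frame // /s1 den_frame // cur.
have v2 : s2.1 VI 0 = i by rewrite /s2 den_frame // /s1 den_frame.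
have [sf3 c3] := emit_spec v2 ld2 i2 g2 c2.
rewrite /step den_seqs3 -/s1 -/s2.
split; first exact: safe_seqs3 sf1 sf2 sf3.
split; last exact: c3.
by apply: bfs_inv_frame i2 => a ca; rewrite den_frame //; case: a ca.
Qed.

End Explore.

(** * The search for the best table *)

Section Candidate.
Variables (n : nat) (T : gluing n) (t0 : 'I_n) (p : 'S_4).
Hypothesis conn : face_connected T.

Local Notation inp := (tape T).
Local Notation B := (bound n).

Lemma start_spec (s : state) : s.1 VN 0 = n -> s.1 VStart 0 = t0 ->
  safe inp B (start p) s /\ bfs_inv T t0 p 0 (den inp (start p) s).1.
Proof.
move=> sn st.
rewrite /start den_seqs4.
set s1 := den inp clear s.
set s2 := den inp enter s1.
set s3 := den inp (start_per p) s2.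
set s4 := den inp (start_ipr p) s3.
suff [sf1 sf2 sf3 sf4 fin] : [/\ safe inp B clear s, safe inp B enter s1,
    safe inp B (start_per p) s2, safe inp B (start_ipr p) s3 & bfs_inv T t0 p 0 s4.1].
  by split; [exact: safe_seqs4 sf1 sf2 sf3 sf4|exact: fin].
have [//|k t|sf1] := @for_spec inp B VI VN (PSet Lab (var VI) (Lit 0)) s
  (fun k t => forall y, y < k -> t.1 Lab y = 0) isT.
  move=> kn tk _ h; split=> // y yk; rewrite /= /put /same /= tk.
  by case: eqP => // ne; apply: h; lia.
rewrite sn -/clear -/s1 => L1.
have F1 a : ~~ same a VI -> ~~ same a Lab -> s1.1 a = s.1 a.
  by move=> h1 h2; rewrite /s1 den_frame //; case: a h1 h2.
rewrite -/clear in sf1; clearbody s1.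
have E2 : s2 = (put (put (put s1.1 Lab t0 1) Tet 0 t0) VCnt 0 1, s1.2).
  by rewrite /s2 /= /put /same /= F1 // st.
have sf2 : safe inp B enter s1.
  by have := ltn_ord t0; rewrite /= /put /same /= F1 // st /bound; do !split=> //; lia.
clearbody s2.
have st2 : s2.1 VStart 0 = t0 by rewrite E2 /= put_neq // put_neq // put_neq // F1.
have [//|c|c c' _ _|sf3 in3 _] := @fill_spec inp B Per
  (fun v => Plus (Quad (var VStart)) (Lit v)) (fun v => Lit (p (inord v))) (iota 0 4) s2.
- by move=> _; have := ltn_ord (p (inord c)); rewrite /= /bound; lia.
- by rewrite /= => /addnI ->.
have F3 a : ~~ same a Per -> s3.1 a = s2.1 a.
  by move=> h; rewrite /s3 den_frame //; case: a h.
have P3 (v : 'I_4) : s3.1 Per (4 * t0 + v) = p v.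
  by have := in3 v; rewrite mem_iota ltn_ord /= st2 inord_val => ->.
rewrite -/(start_per p) in sf3.
clear in3; clearbody s3.
have st3 : s3.1 VStart 0 = t0 by rewrite F3.
have [//|c|c c' _ _|sf4 in4 _] := @fill_spec inp B Ipr
  (fun v => Plus (Quad (var VStart)) (Lit v)) (fun v => Lit ((p^-1)%g (inord v))) (iota 0 4) s3.
- by move=> _; have := ltn_ord ((p^-1)%g (inord c)); rewrite /= /bound; lia.
- by rewrite /= => /addnI ->.
have F4 a : ~~ same a Ipr -> s4.1 a = s3.1 a.
  by move=> h; rewrite /s4 den_frame //; case: a h.
have P4 (v : 'I_4) : s4.1 Ipr (4 * t0 + v) = (p^-1)%g v.
  by have := in4 v; rewrite mem_iota ltn_ord /= st3 inord_val => ->.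
rewrite -/(start_ipr p) in sf4.
clear in4; clearbody s4.
split=> //; split=> /=.
- by rewrite F4 // F3 // E2.
- by case=> // _; rewrite F4 // F3 // E2.
- move=> y; rewrite F4 // F3 // E2 /= /put /same /= inE.
  have -> : (val y == t0) = (y == t0) by [].
  by rewrite eq_sym; case: eqP => // _; exact: L1.
- by move=> y v; rewrite inE => /eqP ->; rewrite P4 F4 // P3 ffunE.
Qed.

Local Notation new := (new_table t0 p conn).

Lemma explore_spec (s : state) :
  s.1 VN 0 = n -> glue_ok T n s.1 -> bfs_inv T t0 p 0 s.1 ->
  safe inp B explore s /\
  forall j, j < 4 * (4 * n) -> (den inp explore s).1 Cur j = nth 0 new j.
Proof.
move=> sn gk is_.
have [||k t|sf] := @for_spec inp B VI VN (seqs [seq step f | f <- iota 0 4]) s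
  (fun k t => bfs_inv T t0 p (4 * k) t.1 /\ cur_inv t0 p conn (4 * k) t.1).
- by [].
- split; last by move=> j; rewrite muln0.
  by apply: bfs_inv_frame is_ => a ca; rewrite /= put_neq //; case: a ca.
- rewrite sn => kn tk fr [ti tc].
  pose J m (r : state) := [/\ r.1 VI 0 = k, glue_ok T n r.1,
    bfs_inv T t0 p (4 * k + m) r.1 & cur_inv t0 p conn (4 * k + m) r.1].
  have [f r [rk gr ir cr]||sf4] := @seqs4_spec n T step J _ t.
  + have [sf1 [i1 c1]] := @step_spec n T t0 p conn (Ordinal kn) f r rk ir gr cr.
    split; first exact: sf1.
    split; [by rewrite den_frame| |by rewrite addnS|by rewrite addnS].
    by move=> y z v yn; rewrite den_frame // gr.
  + split=> //; [|by rewrite addn0|by rewrite addn0].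
    by move=> y z v yn; rewrite fr // gk.
  set r := den inp _ t => -[_ _ ir cr].
  split; first exact: sf4.
  clearbody r; rewrite mulnS addnC; split.
    by apply: bfs_inv_frame ir => a ca; rewrite /= put_neq //; case: a ca.
  by move=> j jk; rewrite /= put_neq // cr.
by rewrite sn => -[_ h]; split.
Qed.

Local Notation lex c b := ((c : seqlexi nat) < (b : seqlexi nat))%O.

Lemma compare_spec (s : state) (c b : seq nat) : s.1 VN16 0 = 4 * (4 * n) ->
  size c = 4 * (4 * n) -> size b = 4 * (4 * n) ->
  (forall j, j < 4 * (4 * n) -> s.1 Cur j = nth 0 c j) ->
  (forall j, j < 4 * (4 * n) -> s.1 Best j = nth 0 b j) ->
  safe inp B compare s /\ (den inp compare s).1 VCmp 0 = lex c b.
Proof.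
set N := 4 * (4 * n) => sN sc sb hc hb.
rewrite /compare; set body := seqs [:: setv VX _; _].
set s1 : state := (put s.1 VCmp 0 0, s.2).
have -> : den inp (seqs [:: setv VCmp (Lit 0); PFor VI VN16 body]) s
  = den inp (PFor VI VN16 body) s1 by [].
have s1N : s1.1 VN16 0 = N by rewrite /= put_neq.
(* After [k] rounds the verdict is that of the last [k] entries; an entry in front decides unless it
   is a tie, which keeps the verdict. *)
have [//||k t|sf] := @for_spec inp B VI VN16 body s1
  (fun k t => t.1 VCmp 0 = lex (drop (N - k) c) (drop (N - k) b)).
- by rewrite subn0 !drop_oversize ?sc ?sb.
- rewrite s1N => kN tk fr tc.
  have tN : t.1 VN16 0 = N by rewrite fr.
  have kN' : N - k.+1 < N by lia.
  have tC : t.1 Cur (N - k.+1) = nth 0 c (N - k.+1) by rewrite fr // /= put_neq // hc.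
  have tB : t.1 Best (N - k.+1) = nth 0 b (N - k.+1) by rewrite fr // /= put_neq // hb.
  rewrite (drop_nth 0) ?sc // (drop_nth 0 (s := b)) ?sb // ltxi_cons.
  rewrite (_ : (N - k.+1).+1 = N - k); last by lia.
  rewrite /body /= /put /same /= tN tk !addn1 tC tB.
  rewrite !subn_eq0 -!ltnNge.
  case: (ltngtP (nth 0 c (N - k.+1)) (nth 0 b (N - k.+1))) => cb /=;
    rewrite /put /same /= ?leEnat.
  + by split; [rewrite /bound; split=> //; lia|rewrite (ltnW cb) leqNgt cb].
  + by split; [rewrite /bound; split=> //; lia|rewrite leqNgt cb].
  + by split; [rewrite /bound; split=> //; lia|rewrite cb leqnn tc].
rewrite s1N subnn !drop0 => h; split; last exact: h.
by split.
Qed.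

Lemma keep_min_spec (s : state) (c b : seq nat) : s.1 VN16 0 = 4 * (4 * n) ->
  (forall j, nth 0 c j <= B) ->
  (forall j, j < 4 * (4 * n) -> s.1 Cur j = nth 0 c j) ->
  (forall j, j < 4 * (4 * n) -> s.1 Best j = nth 0 b j) ->
  s.1 VCmp 0 = lex c b ->
  safe inp B keep_min s /\
  forall j, j < 4 * (4 * n) ->
    (den inp keep_min s).1 Best j = nth 0 (if lex c b then c else b) j.
Proof.
set N := 4 * (4 * n) => sN bc hc hb cmp.
have cE : aeval inp s.1 (var VCmp) = lex c b by [].
rewrite /keep_min safe_if den_if cE.
case: (boolP (lex c b)) => _; cbv iota; last by split.
have [|k t|sf] := @for_spec inp B VI VN16 (PSet Best (var VI) (Cell Cur (var VI))) s
  (fun k t => forall j, j < k -> t.1 Best j = nth 0 c j) isT.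
- by [].
- rewrite sN => kN tk fr tb.
  have tC : t.1 Cur k = nth 0 c k by rewrite fr // hc.
  rewrite /= tk tC; split=> // j jk; rewrite /put /same /=.
  by case: eqP => [->|ne] //; apply: tb; lia.
by rewrite sN => h; split; [exact: sf|exact: h].
Qed.

Lemma size_new : size new = 4 * (4 * n).
Proof. exact: size_table. Qed.

Lemma new_bound j : nth 0 new j <= B.
Proof. exact: (@inp_bound n (relabel T (bfs_lab t0 p conn)) j.+1). Qed.

Definition smaller (c b : seq nat) : seq nat := if lex c b then c else b.

Definition best_is (b : seq nat) (s : store) : Prop :=
  forall j, j < 4 * (4 * n) -> s Best j = nth 0 b j.

Lemma candidate_spec (s : state) (b : seq nat) :
  context T s.1 -> s.1 VStart 0 = t0 -> size b = 4 * (4 * n) -> best_is b s.1 ->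
  safe inp B (candidate p) s /\ best_is (smaller new b) (den inp (candidate p) s).1.
Proof.
move=> [sN sN4 sN16 _ [_ _ gk]] st sb hb.
rewrite /candidate den_seqs4.
set s1 := den inp (start p) s.
set s2 := den inp explore s1.
set s3 := den inp compare s2.
set s4 := den inp keep_min s3.
suff [sf1 sf2 sf3 sf4 fin] : [/\ safe inp B (start p) s, safe inp B explore s1,
    safe inp B compare s2, safe inp B keep_min s3 & best_is (smaller new b) s4.1].
  by split; [exact: safe_seqs4 sf1 sf2 sf3 sf4|exact: fin].
have [sf1 i1] := start_spec sN st.
rewrite -/s1 in i1.
have F1 a : (code a < 8) -> s1.1 a = s.1 a.
  by move=> h; rewrite /s1 den_frame //; case: a h.
clearbody s1.
have gk1 : glue_ok T n s1.1 by move=> y z v yn; rewrite F1 // gk.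
have sN1 : s1.1 VN 0 = n by rewrite F1.
have [sf2 c2] := explore_spec sN1 gk1 i1.
rewrite -/s2 in c2.
have F2 a : (code a < 8) -> s2.1 a = s.1 a.
  by move=> h; rewrite /s2 den_frame ?F1 //; case: a h.
clearbody s2.
have sN2 : s2.1 VN16 0 = 4 * (4 * n) by rewrite F2.
have b2 : best_is b s2.1 by move=> j jn; rewrite F2 // hb.
have [sf3 c3] := compare_spec sN2 size_new sb c2 b2.
rewrite -/s3 in c3.
have F3 a : ~~ writes compare a -> s3.1 a = s2.1 a.
  by move=> h; rewrite /s3 den_frame.
clearbody s3.
have sN3 : s3.1 VN16 0 = 4 * (4 * n) by rewrite F3.
have b3 : best_is b s3.1 by move=> j jn; rewrite F3 // b2.
have c3' j : j < 4 * (4 * n) -> s3.1 Cur j = nth 0 new j.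
  by move=> jn; rewrite F3 // c2.
have [sf4 b4] := keep_min_spec sN3 new_bound c3' b3 c3.
by split.
Qed.

End Candidate.

(** * The minimum over all candidates *)

Section Search.
Variables (n : nat) (T : gluing n).
Hypothesis conn : face_connected T.

Local Notation inp := (tape T).
Local Notation B := (bound n).
Local Notation new t p := (new_table t p conn).
Local Notation N := (4 * (4 * n)).

Definition best_of (b : seq nat) (cs : seq (seq nat)) : seq nat :=
  foldl (fun b c => smaller c b) b cs.

Lemma size_best_of b cs : size b = N -> all (fun c => size c == N) cs ->
  size (best_of b cs) = N.
Proof.
elim: cs b => //= c cs IH b sb /andP[/eqP sc scs]; apply: IH => //.
by rewrite /smaller; case: ifP.
Qed.

Lemma candidates_spec (t : 'I_n) (ps : seq 'S_4) (s : state) (b : seq nat) :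
  context T s.1 -> s.1 VStart 0 = t -> size b = N -> best_is n b s.1 ->
  safe inp B (seqs [seq candidate p | p <- ps]) s /\
  best_is n (best_of b [seq new t p | p <- ps]) (den inp (seqs [seq candidate p | p <- ps]) s).1.
Proof.
elim: ps s b => [|p ps IH] s b cs st sb hb; first by split.
rewrite [map _ _]/= [map (fun p => new t p) _]/=.
have [sf1 b1] := candidate_spec p conn cs st sb hb.
set s1 := den inp (candidate p) s in b1.
have cs1 : context T s1.1.
  by apply: context_frame cs => a ha; rewrite /s1 den_frame //; case: a ha.
have st1 : s1.1 VStart 0 = t by rewrite /s1 den_frame.
have sb1 : size (smaller (new t p) b) = N by rewrite /smaller; case: ifP => // _; exact: size_new.
have [sf2 b2] := IH s1 _ cs1 st1 sb1 b1.
by rewrite den_cons -/s1; split; [exact: safe_cons sf1 sf2|exact: b2].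
Qed.

Definition candidates : seq (seq nat) :=
  flatten [seq [seq new t p | p <- enum 'S_4] | t <- enum 'I_n].

Lemma search_spec (s : state) (b : seq nat) :
  context T s.1 -> size b = N -> best_is n b s.1 ->
  safe inp B search s /\ best_is n (best_of b candidates) (den inp search s).1.
Proof.
move=> cs sb hb.
have sN : s.1 VN 0 = n by case: cs.
pose done_ k := flatten [seq [seq new t p | p <- enum 'S_4] | t <- take k (enum 'I_n)].
rewrite /search; set body := seqs _.
have wb a : code a < 8 -> writes body a -> a = Best.
  rewrite /body writes_seqs has_map => ha /hasP[p _].
  by case: a ha.
have wf_b : wf (PFor VStart VN body) by exact: wf_search.
have [|k t|sf] := @for_spec inp B VStart VN body s
  (fun k t => context T t.1 /\ best_is n (best_of b (done_ k)) t.1) wf_b.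
- split; first by apply: context_frame cs => a ha; rewrite /= put_neq //; case: a ha.
  by move=> j jN; rewrite /= put_neq // /done_ take0 hb.
- rewrite sN => kn tk fr [ct bt].
  have sz : size (best_of b (done_ k)) = N.
    apply: size_best_of => //; apply/allP => c /flattenP[cs' /mapP[t' _ ->] /mapP[p _ ->]].
    by rewrite size_new.
  have [sf1 b1] := @candidates_spec (Ordinal kn) (enum 'S_4) t _ ct tk sz bt.
  rewrite -/body in sf1 b1; split; first exact: sf1.
  have F a : code a < 7 -> (den inp body t).1 a = t.1 a.
    move=> ha; rewrite den_frame //; apply/negP => h.
    by move: (ha); rewrite (wb a _ h) // (ltn_trans ha).
  move: b1 F; move: (den inp body t) => r b1 F; split.
    by apply: context_frame ct => a ha; rewrite /= put_neq ?F //; case: a ha.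
  move=> j jN; rewrite /= put_neq // b1 // /done_ (take_nth (Ordinal kn)) ?size_enum_ord //.
  rewrite -cats1 map_cat flatten_cat /= cats0 /best_of foldl_cat.
  by have -> : nth (Ordinal kn) (enum 'I_n) k = Ordinal kn by exact: (nth_ord_enum _ (Ordinal kn)).
rewrite sN => -[_ h]; split; first exact: sf.
by move=> j jN; rewrite h // /done_ take_oversize // size_enum_ord.
Qed.

Lemma best_of_le b cs (c : seq nat) : c \in b :: cs ->
  ((best_of b cs : seqlexi nat) <= (c : seqlexi nat))%O.
Proof.
have le_smaller x y : ((smaller x y : seqlexi nat) <= (x : seqlexi nat))%O /\
    ((smaller x y : seqlexi nat) <= (y : seqlexi nat))%O.
  by rewrite /smaller; case: ltP => h; split=> //; rewrite ?ltW.
elim: cs b c => [|d cs IH] b c; first by rewrite inE => /eqP ->.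
have [h1 h2] := le_smaller d b.
have h := IH (smaller d b) _ (mem_head _ _).
rewrite !inE => /or3P[/eqP ->|/eqP ->|cc] /=.
- exact: le_trans h h2.
- exact: le_trans h h1.
- by apply: IH; rewrite inE cc orbT.
Qed.

Lemma best_of_mem b cs : best_of b cs \in b :: cs.
Proof.
elim: cs b => [|d cs IH] b; first by rewrite mem_head.
have := IH (smaller d b); rewrite !inE /= => /orP[/eqP ->|->]; last by rewrite !orbT.
by rewrite /smaller; case: ifP => _; rewrite eqxx ?orbT.
Qed.

(* Above all tables, whose first entry is a label. *)
Definition top : seq nat := n :: nseq N.-1 0.

(** The candidates are the tables of all searches, hence of all canonical labellings; the fold
    returns one of them and not the starting value. *)
Lemma best_of_candidates : 0 < n ->
  exists l : labelling n, [/\ Defs.canonical (relabel T l),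
    best_of top candidates = table (relabel T l)
  & forall l', Defs.canonical (relabel T l') ->
    ((table (relabel T l) : seqlexi nat) <= (table (relabel T l') : seqlexi nat))%O].
Proof.
move=> n0; pose o := Ordinal n0.
have all_c l' : Defs.canonical (relabel T l') -> table (relabel T l') \in candidates.
  move=> cl; rewrite (canonical_is_bfs (o := o) erefl cl conn).
  set t := (l'.1^-1)%g o; set p := l'.2 t.
  apply/flattenP; exists [seq new t p | p <- enum 'S_4].
    by apply/mapP; exists t; rewrite ?mem_enum.
  by apply/mapP; exists p; rewrite ?mem_enum.
have := best_of_mem top candidates; rewrite inE => /orP[/eqP e|].
  (* Were [top] the least, it would lie below the candidate started at [o]; but its first entry [n]
     exceeds every label. *)
  have := @best_of_le top candidates (new o 1%g); rewrite e inE all_c ?orbT; last exact: canonical_bfs.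
  move=> /(_ isT); rewrite /top.
  have := nth_table_adj (relabel T (bfs_lab o 1%g conn)) o ord0.
  rewrite -/(new_table o 1%g conn); case: (new_table _ _ _) (size_new o 1%g conn) => [|a r _] /=.
    by lia.
  move=> ->; rewrite lexi_cons => /andP[]; rewrite leEnat => le _.
  by move: le; rewrite leqNgt ltn_ord.
case/flattenP => cs /mapP[t _ ->] /mapP[p _ e].
exists (bfs_lab t p conn); split; [exact: canonical_bfs|exact: e|].
move=> l' cl; have -> : table (relabel T (bfs_lab t p conn)) = best_of top candidates by rewrite e.
by apply: best_of_le; rewrite inE all_c ?orbT.
Qed.

End Search.

(** * Output and correctness *)

Definition bits (s : seq bool) : seq nat := [seq nat_of_bool b | b <- s].

Lemma bits_cat s t : bits (s ++ t) = bits s ++ bits t.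
Proof. exact: map_cat. Qed.

Section Print.
Variables (n : nat) (T : gluing n).

Local Notation inp := (tape T).
Local Notation B := (bound n).

Lemma print_spec (w : name) (s : state) (W : nat) :
  w = VW \/ w = VTwo -> s.1 w 0 = W -> s.1 VX 0 < 2 ^ W -> 2 ^ W.-1 <= B ->
  (forall i, i < W -> s.1 Pow i = 2 ^ i) ->
  safe inp B (print_bin w) s /\
  (den inp (print_bin w) s).2 = s.2 ++ bits (binary W (s.1 VX 0)).
Proof.
move=> wE sW kW WB pw; rewrite /print_bin; set body := seqs _.
have wfb : wf (PFor VJ w body) by case: wE => ->.
(* [VX] holds the remainder still to be printed: the output so far, followed by its [W - j] digits,
   is constant. *)
have [|j t|sf] := @for_spec inp B VJ w body s (fun j t => t.1 VX 0 < 2 ^ (W - j) /\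
  t.2 ++ bits (binary (W - j) (t.1 VX 0)) = s.2 ++ bits (binary W (s.1 VX 0))) wfb.
- by rewrite /= put_neq // subn0.
- rewrite sW => jW tj fr [xl out].
  have tW : t.1 w 0 = W by rewrite fr // ?sW //; case: wE => ->.
  have tP : t.1 Pow (W - j.+1) = 2 ^ (W - j.+1) by rewrite fr; [apply: pw; lia|case: wE => ->].
  have e : W - j = (W - j.+1).+1 by lia.
  rewrite /body /= /put /same /= tW tj addn1 tP.
  have YB : 2 ^ (W - j.+1) <= B.
    by apply: leq_trans WB; rewrite leq_pexp2l //; lia.
  move: xl out; rewrite e; move: (W - j.+1) tP YB => m tP YB xl.
  rewrite binaryS // => out.
  have bE : (1 - (2 ^ m - t.1 VX 0)) = (2 ^ m <= t.1 VX 0) by case: leqP; lia.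
  rewrite bE; rewrite /= in out; rewrite expnS in xl.
  case: (leqP (2 ^ m) (t.1 VX 0)) out => hx /= out.
    split; first by rewrite /bound in YB *; do !split=> //; lia.
    by split; [lia|rewrite cat_rcons].
  split; first by rewrite /bound in YB *; do !split=> //; lia.
  by split=> //; rewrite cat_rcons.
rewrite sW subnn => -[_]; rewrite cats0 => h; split; [exact: sf|exact: h].
Qed.

Lemma bitlen_bound : 2 ^ (bitlen n.-1).-1 <= B.
Proof.
rewrite /bitlen /bound /=; case: (posnP n.-1) => [->|h]; first by rewrite trunc_log0 addnS.
by apply: leq_trans (trunc_logP (isT : 1 < 2) h) _; lia.
Qed.

Definition row_bits (w : nat) (r : seq nat) (m : nat) : seq bool :=
  flatten [seq binary (if c == 0 then w else 2) (nth 0 r c) | c <- iota 0 m].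

Lemma row_bitsS w r m : row_bits w r m.+1
  = row_bits w r m ++ binary (if m == 0 then w else 2) (nth 0 r m).
Proof. by rewrite /row_bits -(addn1 m) iotaD map_cat flatten_cat /= cats0. Qed.

Lemma row_bits4 w r : size r = 4 -> row_bits w r 4 = enc_row w r.
Proof.
by case: r => [|a [|b [|c [|d []]]]] // _.
Qed.

Lemma print_entry_spec (T' : gluing n) (i : nat) (c : 'I_4) (s : state) :
  context T s.1 -> best_is n (table T') s.1 -> i < 4 * n -> s.1 VI 0 = i ->
  safe inp B (print_entry c) s /\
  (den inp (print_entry c) s).2
  = s.2 ++ bits (binary (if val c == 0 then bitlen n.-1 else 2)
                        (nth 0 (nth [::] (rows T') i) c)).
Proof.
move=> [sN sN4 sN16 sTwo [sW pw gk]] hb iN si.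
have c4 := ltn_ord c.
have vE : s.1 Best (4 * i + c) = nth 0 (nth [::] (rows T') i) c.
  rewrite hb; last by lia.
  rewrite nth_flatten_const ?size_rows //.
  by apply/allP => r /(allP (wf_rows T'))/andP[].
have /(all_nthP [::])/(_ i) := wf_rows T'; rewrite size_rows => /(_ iN) /and3P[/eqP sr r0 rv].
set s1 : state := (put s.1 VX 0 (s.1 Best (4 * i + c)), s.2).
have vlt : nth 0 (nth [::] (rows T') i) c < 2 ^ (if val c == 0 then bitlen n.-1 else 2).
  move: r0 rv sr c4 {vE s1}; case: (nth [::] (rows T') i) => // a r /= r0 rv [sr] c4.
  case: (val c) c4 => //= m m4; apply: (allP rv); by apply: mem_nth; rewrite sr.
have vB : s.1 Best (4 * i + c) <= B.
  by rewrite hb; [exact: (@inp_bound n T' (4 * i + c).+1)|lia].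
pose w := if val c == 0 then VW else VTwo.
pose W := if val c == 0 then bitlen n.-1 else 2.
have wE : w = VW \/ w = VTwo by rewrite /w; case: ifP; [left|right].
have sw : s1.1 w 0 = W by rewrite /w /W; case: ifP => _; rewrite /= put_neq.
have WB : 2 ^ W.-1 <= B by rewrite /W; case: ifP => _; [exact: bitlen_bound|exact: leq_trans (leq_addl _ _)].
have WW : W <= (bitlen n.-1).+1 by rewrite /W; case: ifP => _; rewrite // ltnS bitlen_gt0.
have xE : s1.1 VX 0 = nth 0 (nth [::] (rows T') i) c by rewrite -vE.
have pw' j : j < W -> s1.1 Pow j = 2 ^ j.
  by move=> jW; rewrite /= put_neq // pw // sW -ltnS (leq_trans jW).
rewrite -xE in vlt.
have [sf out] := print_spec wE sw vlt WB pw'.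
have -> : den inp (print_entry c) s = den inp (print_bin w) s1.
  by rewrite /print_entry -/w /s1 /= si.
split; last by rewrite out xE.
by split; [rewrite /= si|move: sf; rewrite /s1 /= si].
Qed.

Lemma print_best_spec (T' : gluing n) (s : state) :
  context T s.1 -> best_is n (table T') s.1 ->
  safe inp B print_best s /\
  (den inp print_best s).2 = s.2 ++ bits (encode T').
Proof.
move=> cs hb.
have sN4 : s.1 VN4 0 = 4 * n by case: cs.
pose out k := bits (flatten [seq enc_row (bitlen n.-1) r | r <- take k (rows T')]).
have [||i t|sf] := @for_spec inp B VI VN4 (seqs [seq print_entry c | c <- iota 0 4]) s
  (fun k t => t.2 = s.2 ++ out k).
- by [].
- by rewrite /= /out take0 cats0.
- rewrite sN4 => iN ti fr to.
  pose r := nth [::] (rows T') i.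
  have tc : context T t.1.
    by apply: context_frame cs => a ha; rewrite fr //; case: a ha.
  have tb : best_is n (table T') t.1 by move=> j jN; rewrite fr // hb.
  pose J m (u : state) := [/\ context T u.1, best_is n (table T') u.1, u.1 VI 0 = i
    & u.2 = t.2 ++ bits (row_bits (bitlen n.-1) r m)].
  have [c u [uc ub ui uo]||sf4] := @seqs4_spec n T print_entry J _ t.
  + have [sf1 o1] := print_entry_spec c uc ub iN ui.
    have F a : code a < 10 -> (den inp (print_entry c) u).1 a = u.1 a.
      by move=> ha; rewrite den_frame //; case: (c) => -[|m] ? /=; case: a ha.
    split; first exact: sf1.
    split; [|by move=> j jN; rewrite F // ub|by rewrite F|].
      by apply: context_frame uc => a ha; rewrite F // (ltn_trans ha).
    by rewrite o1 uo row_bitsS bits_cat catA.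
  + by split=> //; rewrite cats0.
  set v := den inp _ t => -[_ _ _ vo].
  split; first exact: sf4.
  rewrite [LHS]vo to /out (take_nth [::]) ?size_rows // -cats1 map_cat flatten_cat bits_cat.
  rewrite catA row_bits4 /= ?cats0 //.
  by have /(all_nthP [::])/(_ i) := wf_rows T'; rewrite size_rows => /(_ iN) /and3P[/eqP sr _ _].
rewrite sN4 /out take_oversize ?size_rows // => h; split; first exact: sf.
by rewrite encodeE.
Qed.

Lemma constants_spec (s0 : state) : s0 = (fun _ _ => 0, [::]) ->
  [/\ safe inp B constants s0,
      [/\ (den inp constants s0).1 VN 0 = n, (den inp constants s0).1 VN4 0 = 4 * n,
          (den inp constants s0).1 VN16 0 = 4 * (4 * n) & (den inp constants s0).1 VTwo 0 = 2],
      best_is n (top n) (den inp constants s0).1 & (den inp constants s0).2 = [::]].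
Proof.
move=> ->; have i0 : inp 0 = n by [].
rewrite /best_is /top /= /put /same /= i0.
split=> //; first by rewrite /bound; do !split=> //; lia.
move=> [|j] jN //=; rewrite nth_nseq; case: ifP => //.
Qed.

Lemma main_spec (s0 : state) : 0 < n -> face_connected T -> s0 = (fun _ _ => 0, [::]) ->
  safe inp B main s0 /\ (den inp main s0).2 = bits (isosig T).
Proof.
move=> n0 conn s0E.
rewrite /main den_seqs5.
set s1 := den inp constants s0.
set s2 := den inp powers s1.
set s3 := den inp copy_input s2.
set s4 := den inp search s3.
set s5 := den inp print_best s4.
suff [sf1 sf2 sf3 [sf4 sf5] fin] : [/\ safe inp B constants s0, safe inp B powers s1,
    safe inp B copy_input s2, safe inp B search s3 /\ safe inp B print_best s4
    & s5.2 = bits (isosig T)].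
  by split; [exact: safe_seqs5 sf1 sf2 sf3 sf4 sf5|exact: fin].
have [sf1 [c1 c2 c3 c4] b1 o1] := constants_spec s0E.
rewrite -/s1 in c1 c2 c3 c4 b1 o1; clearbody s1.
have [sf2 p2 w2] := @powers_spec n T s1 n0 c1.
rewrite -/s2 in p2 w2.
have F2 a : ~~ writes powers a -> s2.1 a = s1.1 a by move=> h; rewrite /s2 den_frame.
have o2 : s2.2 = [::] by rewrite /s2 den_silent.
clearbody s2.
have c1' : s2.1 VN 0 = n by rewrite F2.
have [sf3 g3] := @copy_input_spec n T s2 c1'.
rewrite -/s3 in g3.
have F3 a : ~~ writes copy_input a -> s3.1 a = s2.1 a by move=> h; rewrite /s3 den_frame.
have o3 : s3.2 = [::] by rewrite /s3 den_silent.
clearbody s3.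
have ctx : context T s3.1.
  split; [by rewrite F3 ?F2|by rewrite F3 ?F2|by rewrite F3 ?F2|by rewrite F3 ?F2|].
  by split; [rewrite F3|move=> i; rewrite !F3 //; exact: p2|exact: g3].
have b3 : best_is n (top n) s3.1 by move=> j jN; rewrite F3 // F2 // b1.
have sztop : size (top n) = 4 * (4 * n) by rewrite /= size_nseq prednK //; lia.
have [sf4 b4] := search_spec conn ctx sztop b3.
rewrite -/s4 in b4.
have F4 a : code a < 7 -> s4.1 a = s3.1 a.
  move=> ha; rewrite /s4 den_frame //; apply/negP => /writes_search[p].
  by case: a ha.
have o4 : s4.2 = [::].
  rewrite /s4 den_silent ?o3 // /search; cbn [silent].
  by rewrite silent_seqs all_map; apply/allP.
clearbody s4.
have [l [cl lE lmin]] := best_of_candidates conn n0.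
have ctx4 : context T s4.1 by apply: context_frame ctx.
rewrite lE in b4.
have [sf5 o5] := print_best_spec ctx4 b4.
split=> //; rewrite /s5 o5 o4 /= (isosig_min cl) // => l' cl'.
by rewrite encode_le; exact: lmin.
Qed.

End Print.

Lemma main_outputs n (T : gluing n) : 0 < n -> face_connected T ->
  exists k, outputs (compile main) (input_table T) (isosig T) k
    /\ k <= coef main * bound n ^ 2 * bitlen (bound n).
Proof.
move=> n0 conn.
pose s0 : state := (fun _ _ => 0, [::]).
have [sf out] := main_spec n0 conn (erefl s0).
have B0 : 0 < bound n by rewrite /bound addnS.
have [m [k [w [ex _ _ o kB]]]] := @compile_correct (tape T) (bound n) B0 (@inp_bound n T)
  main s0 wf_main sf (fun=> 0) (fun _ _ => erefl) (fun _ => leq0n _).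
have wE : bits (isosig T) = w by rewrite -out o.
exists k; split; first by exists m; rewrite -/(bits _) wE; exact: ex.
apply: leq_trans kB _; rewrite leq_mul2r leq_mul2l leq_pexp2l ?orbT //.
exact: depth_main.
Qed.

(** * Asymptotics *)

Local Open Scope classical_set_scope.
Local Open Scope ring_scope.

(** The successor in [bitlen] costs one more [ln 2], which is at most [ln n] from [n = 2] on; hence
    the factor 2. *)
Lemma bitlen_ln (R : realType) n : (1 < n)%N -> (bitlen n)%:R * ln 2 <= 2 * ln n%:R :> R.
Proof.
move=> n1; have n0 : (0 < n)%N by exact: ltnW.
have ln2 : ln 2 <= ln n%:R :> R by rewrite ler_ln ?posrE ?ltr0n // ler_nat.
have : (trunc_log 2 n)%:R * ln 2 <= ln n%:R :> R.
  rewrite mulr_natl -lnXn ?ltr0n // ler_ln ?posrE ?exprn_gt0 ?ltr0n //.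
  by rewrite -natrX ler_nat trunc_logP.
by move=> h; rewrite /bitlen -addn1 natrD mulrDl mul1r [leRHS]mulr_natl mulr2n lerD.
Qed.

Lemma bigO_ln (R : realType) (f : nat -> nat) (c d : nat) :
  (forall n, (1 < n)%N -> (f n <= c * n ^ d * bitlen n)%N) ->
  (fun n => (f n)%:R : R) =O_\oo (fun n => n%:R ^+ d * ln n%:R).
Proof.
(* The factor [2 / ln 2] converts digits into logarithms; the summand 1 keeps the constant positive
   when [c = 0]. *)
move=> fc; apply/eqO_exP; exists ((c%:R + 1) * (2 / ln 2)).
  by rewrite mulr_gt0 ?ltr_wpDl ?ltr01 ?ler0n ?divr_gt0 ?ln_gt0 ?ltr1n ?ltr0n.
exists 2 => // n /= n2.
have ln2 : 0 < ln 2 :> R by rewrite ln_gt0 ?ltr1n.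
have lnn : 0 <= ln n%:R :> R by rewrite ln_ge0 // ler1n ltnW.
rewrite ger0_norm ?ler0n // ger0_norm ?mulr_ge0 ?exprn_ge0 ?ler0n //.
have h1 : (f n)%:R <= c%:R * n%:R ^+ d * (bitlen n)%:R :> R.
  by rewrite -natrX -!natrM ler_nat fc.
apply: le_trans h1 _.
have h2 : (bitlen n)%:R <= 2 / ln 2 * ln n%:R :> R.
  by rewrite mulrAC ler_pdivlMr // bitlen_ln.
rewrite [leRHS]mulrACA; apply: ler_pM => //.
by rewrite ler_wpM2r ?exprn_ge0 ?ler0n // lerDl ler01.
Qed.

(** Here [16 * n + 16 <= 32 * n], and 7 is the 6 digits of 32 plus one unit for [bitlen n]
    itself. *)
Lemma bound_time C n : (1 < n)%N ->
  (C * bound n ^ 2 * bitlen (bound n) <= C * (32 ^ 2 * 7) * n ^ 2 * bitlen n)%N.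
Proof.
move=> n1; have bn : (bound n <= 32 * n)%N by rewrite /bound; lia.
have bl : (bitlen (bound n) <= 7 * bitlen n)%N.
  apply: leq_trans (leq_bitlen bn) _; apply: leq_trans (bitlenM _ _) _.
  by rewrite (_ : bitlen 32 = 6%N) // mulSn addnC leq_add2l leq_pmulr.
have -> : (C * (32 ^ 2 * 7) * n ^ 2 * bitlen n = C * (32 * n) ^ 2 * (7 * bitlen n))%N.
  by rewrite expnMn; move: (32 ^ 2)%N (n ^ 2)%N => a b; rewrite !mulnA (mulnAC _ 7).
by rewrite leq_mul // leq_mul2l leq_exp2r // bn orbT.
Qed.

Lemma size_bound n : (1 < n)%N ->
  (4 * n * (bitlen n.-1 + 6) <= 28 * n ^ 1 * bitlen n)%N.
Proof.
move=> n1; rewrite expn1 (_ : 28 * n = 4 * n * 7)%N; last by lia.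
rewrite -[in leqRHS]mulnA leq_mul2l; apply/orP; right.
by rewrite mulSn leq_add ?leq_bitlen ?leq_pred // leq_pmulr.
Qed.

Theorem theorem3p4 (R : realType) :
  (exists s : nat -> R,
     s =O_\oo (fun n => n%:R * ln n%:R) /\
     forall (n : nat) (T : gluing n), triangulation3 R T ->
       (size (isosig T))%:R <= s n) /\
  (exists (p : cmd) (time : nat -> R),
     time =O_\oo (fun n => n%:R ^+ 2 * ln n%:R) /\
     forall (n : nat) (T : gluing n), triangulation3 R T ->
       exists k : nat, outputs p (input_table T) (isosig T) k /\ k%:R <= time n).
Proof.
split.
  exists (fun n => (4 * n * (bitlen n.-1 + 6))%:R); split.
    exact: (@bigO_ln R _ 28 1 size_bound).
  by move=> n T _; rewrite ler_nat size_isosig.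
exists (compile main), (fun n => (coef main * bound n ^ 2 * bitlen (bound n))%:R); split.
  exact: (@bigO_ln R _ _ 2 (@bound_time (coef main))).
move=> n T [n0 pT _ cT].
have [k [ok kB]] := main_outputs n0 (realization_connected pT cT).
by exists k; split=> //; rewrite ler_nat.
Qed.
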